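(* Let $X$ be a symmetric space on $[0,1]$ such that the Kruglov operator $K$ acts boundedly on $X$. Then there exists a universal constant $\beta>0$ such that for every $n\in\mathbb{N}$ and any sequence $\{f_k\}_{k=1}^n\subset X$ of independent random variables, with $S_n=\sum_{k=1}^nf_k$ and $F$ the disjointification of $\{f_k\}_{k=1}^n$, the following inequality holds: $$\|S_n\|_X\le\beta\,\|K\|_{X\to X}\bigl(\bigl\|F^*\chi_{[0,1]}\bigr\|_X+\|S_n\|_{L_1}\bigr).$$
   Context: $\lambda$ is Lebesgue measure; random variables are measurable functions on $([0,1],\lambda)$. For a measurable function $f$, $f^*$ denotes the decreasing rearrangement of $|f|$. A symmetric space $X$ on $[0,1]$ is a Banach space of measurable functions on $[0,1]$ such that $f\in X$ and $g^*\le f^*$ imply $g\in X$ and $\|g\|_X\le\|f\|_X$; always normalized by $\|\chi_{(0,1)}\|_X=1$. The disjointification of $\{f_k\}_{k=1}^n$ is $F(t)=\sum_{k=1}^nf_k(t-k+1)\chi_{[k-1,k]}(t)$, $t>0$. Kruglov operator: let $\{B_n\}_{n\ge1}$ be pairwise disjoint measurable subsets of $[0,1]$ with $\lambda(B_n)=\frac1{e\,n!}$, and let $(\Omega,\mathcal P)=\prod_{n=0}^\infty([0,1],\lambda_n)$ with each $\lambda_n$ Lebesgue measure on $[0,1]$. For $f\in L_1[0,1]$, $$Kf(\omega_0,\omega_1,\dots)=\sum_{n=1}^\infty\sum_{k=1}^n f(\omega_k)\chi_{B_n}(\omega_0).$$ $K$ is a positive linear operator $L_1[0,1]\to L_1(\Omega,\mathcal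 P)$. $\|Kf\|_X$ means $\|(Kf)^*\|_X$; $K$ acts boundedly on $X$ if $\|K\|_{X\to X}:=\sup_{\|f\|_X\le1}\|Kf\|_X<\infty$. *)

(* Defs.v *)
(* Functions on [0,1] are represented by functions R -> R
   of which only the values on `[0,1] matter. *)
From HB Require Import structures.
From mathcomp Require Import all_boot all_order all_algebra.
From mathcomp Require Import all_classical all_reals all_analysis.
Set Implicit Arguments.
Unset Strict Implicit.
Unset Printing Implicit Defensive.
Import Order.TTheory GRing.Theory Num.Theory.
Import numFieldNormedType.Exports.
Local Open Scope classical_set_scope.
Local Open Scope ring_scope.

Definition unit_itv (R : realType) : set R := `[0, 1].
Arguments unit_itv R : clear implicits.

(* f^*(t) for f restricted to D; only meaningful for 0 < t. At t = 0 the infimum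
   may range over the empty set (unbounded f) and is then 0, by convention. *)
Definition rearr (d : measure_display) (T : measurableType d) (R : realType)
    (mu : set T -> \bar R) (D : set T) (f : T -> R) (t : R) : R :=
  inf [set s : R | 0 <= s /\ (mu (D `&` [set x | (s < `|f x|)%R]) <= t%:E)%E].

Definition rearr01 (R : realType) (f : R -> R) : R -> R :=
  rearr (@lebesgue_measure R) (unit_itv R) f.

(* Elements are functions, not classes: functions equal a.e. on [0,1] have the
   same rearrangement, so by [ss_symm] they belong to X together and have the
   same norm; [ss_eq0] is definiteness modulo a.e. equality. The values of
   [ss_norm] outside the carrier carry no meaning. *)
Record symmetricSpace (R : realType) := SymmetricSpace {
  ss_carrier :> (R -> R) -> Prop;
  ss_norm : (R -> R) -> R;
  ss_measurable : forall f, ss_carrier f -> measurable_fun (unit_itv R) f;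
  ss_zero : ss_carrier (cst 0);
  ss_add : forall f g, ss_carrier f -> ss_carrier g -> ss_carrier (f \+ g);
  ss_scale : forall (a : R) f,
    ss_carrier f -> ss_carrier (fun x => a * f x);
  ss_norm_ge0 : forall f, ss_carrier f -> 0 <= ss_norm f;
  ss_eq0 : forall f, ss_carrier f ->
    (ss_norm f = 0 <->
     {ae @lebesgue_measure R, forall x, unit_itv R x -> f x = 0});
  ss_norm_scale : forall (a : R) f, ss_carrier f ->
    ss_norm (fun x => a * f x) = `|a| * ss_norm f;
  ss_norm_add : forall f g, ss_carrier f -> ss_carrier g ->
    ss_norm (f \+ g) <= ss_norm f + ss_norm g;
  ss_complete : forall u : nat -> R -> R,
    (forall n, ss_carrier (u n)) ->
    (forall e : R, 0 < e -> exists N : nat, forall m n : nat,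
       (N <= m)%N -> (N <= n)%N -> ss_norm (u m \- u n) < e) ->
    exists2 f, ss_carrier f &
      (fun n => ss_norm (u n \- f)) @ \oo --> (0 : R);
  ss_symm : forall f g : R -> R, ss_carrier f -> measurable_fun (unit_itv R) g ->
    (forall t : R, 0 < t -> rearr01 g t <= rearr01 f t) ->
    ss_carrier g /\ ss_norm g <= ss_norm f;
  ss_chi01 : ss_carrier \1_(`]0, 1[%classic : set R);
  ss_norm_chi01 : ss_norm \1_(`]0, 1[%classic : set R) = 1
}.

(* Mutual independence on the probability space ([0,1], lebesgue). *)
Definition independent01 (R : realType) (n : nat) (f : 'I_n -> R -> R) : Prop :=
  forall (J : {set 'I_n}) (A : 'I_n -> set R),
    (forall k, measurable (A k)) ->
    lebesgue_measure
      (unit_itv R `&` [set x | forall k, k \in J -> A k (f k x)]) =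
    (\prod_(k in J) lebesgue_measure (unit_itv R `&` f k @^-1` A k))%E.

(* Indices are shifted: k : 'I_n stands for k.+1. *)
Definition disjointification (R : realType) (n : nat) (f : 'I_n -> R -> R)
    (t : R) : R :=
  \sum_(k < n) f k (t - k%:R) * \1_(`[k%:R, k.+1%:R]%classic : set R) t.

Definition disjointification_rearr (R : realType) (n : nat)
    (f : 'I_n -> R -> R) : R -> R :=
  rearr (@lebesgue_measure R) `]0, +oo[ (disjointification f).

(* The product space, carried by sequences in R with the sigma-algebra generated
   by the coordinates; the product measure is concentrated on [0,1]^nat. *)
Definition coordinate_cylinders (R : realType) : set (set (nat -> R)) :=
  [set C | exists (i : nat) (A : set R),
     measurable A /\ C = [set w | A (w i)]].
Arguments coordinate_cylinders R : clear implicits.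

Definition seq_space (R : realType) := g_sigma_algebraType (coordinate_cylinders R).
Arguments seq_space R : clear implicits.

Definition unit_cube (R : realType) : set (seq_space R) :=
  [set w : nat -> R | forall i, unit_itv R (w i)].
Arguments unit_cube R : clear implicits.

(* P is the product over nat of Lebesgue measure on [0,1]; this determines P. *)
Definition is_product_measure (R : realType)
    (P : probability (seq_space R) R) : Prop :=
  forall (m : nat) (A : nat -> set R), (forall i, measurable (A i)) ->
    P [set w : nat -> R | forall i, (i < m)%N -> A i (w i)] =
    (\prod_(i < m) lebesgue_measure (unit_itv R `&` A i))%E.

(* B 0 is not used. *)
Definition kruglov_sets (R : realType) (B : nat -> set R) : Prop :=
  trivIset [set n | (0 < n)%N] B /\
  forall n, (0 < n)%N ->
    [/\ measurable (B n), B n `<=` unit_itv R &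
        lebesgue_measure (B n) = ((expR 1 * n`!%:R)^-1)%:E].

(* For each w, disjointness of the B n leaves at most one nonzero term. *)
Definition kruglov (R : realType) (B : nat -> set R) (f : R -> R)
    (w : nat -> R) : R :=
  limn (fun N => \sum_(1 <= n < N)
                   \sum_(1 <= k < n.+1) f (w k) * \1_(B n) (w 0%N)).

Section KruglovNorm.
Context (R : realType).
Variables (P : probability (seq_space R) R) (B : nat -> set R).
Variable X : symmetricSpace R.

Definition kruglov_rearr (f : R -> R) : R -> R :=
  rearr P (unit_cube R) (kruglov B f).

Definition kruglov_ball_norms : set R :=
  [set ss_norm X (kruglov_rearr f) | f in [set f | X f /\ ss_norm X f <= 1]].

(* The finiteness of the norm of K f includes that K f belongs to X. *)
Definition kruglov_bounded : Prop :=
  (forall f, X f -> X (kruglov_rearr f)) /\ has_ubound kruglov_ball_norms.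

Definition kruglov_norm : R := sup kruglov_ball_norms.

End KruglovNorm.

(* Main.v *)
Require Import Defs.
From HB Require Import structures.
From mathcomp Require Import all_boot all_order all_algebra.
From mathcomp Require Import all_classical all_reals all_analysis measurable_realfun.
From mathcomp Require Import ring lra.
Set Implicit Arguments.
Unset Strict Implicit.
Unset Printing Implicit Defensive.
Import Order.TTheory GRing.Theory Num.Theory.
Import numFieldNormedType.Exports.
Local Open Scope classical_set_scope.
Local Open Scope ring_scope.

(** Why the inequality holds.

    Let [a = F^*(1)] and [N = ||F^* chi_[0,1]||].  Cut every [f_k] at height
    [a], into a large part (where [|f_k| > a]) and a small part, and write [S]
    as the sum of the large parts, plus the centred sum of the small parts,
    plus the sum of the means of the small parts.  Each of the three pieces is
    compared, through its distribution tail, with the image under [K] of a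
    function of [X].

    _Large parts._  The level [a] is chosen so that the measures of the sets
    [|f_k| > a] add up to at most 1, and there the laws of the [|f_k|] add up
    to the law of [phi = F^* chi_[0,1]] above [a].  Expanding a product of
    measures [delta_0 + mu_k] and comparing it with the exponential of
    [mu = sum mu_k] gives, for independent [Z_k >= 0] whose laws on the
    nonzero values are the [mu_k],
      [P(sum_k Z_k > s) <= sum_m (1/m!) mu^{*m}(]s, +oo[)],
    and the right-hand side is at most [e] times the tail of [K phi]
    ([poisson_domination], [tail_sum_large_le]).  Multiplying a tail by a
    constant multiplies the norm by at most a constant ([ss_dilation]), so this
    piece has norm at most [4 ||K|| N].

    _Centred small parts._  They are bounded by [2a], so their fourth moments
    control their variance by their first absolute moment ([variance_le]):
    with [b = O(N + ||S||_1)] the centred sum divided by [b] has summands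
    bounded by 1 and variance at most 1.  Its exponential moments are then at
    most those of a centred Poisson(1) variable, which gives the tail bound
    [2/m!] at the integer [m] ([two_sided_tail_le_invfact]).  As [K 1] is a
    Poisson(1) variable, with tail at least [1/(e m!)], the norm of this piece
    is [O(b ||K||)] ([norm_le_poisson_tail]).

    _Means._  The sum of the means is at most [||S||_1 + N], and
    [1 <= 4 ||K||] ([one_le_kruglov_norm]) since [K 1] is not small.

    The last two pieces need the [L_1] norm of the large parts to be at most
    [N]; this is the embedding of [X] into [L_1] with constant 1
    ([ss_integral_le_norm]). *)

(** * Independence and sums of independent variables *)

(** The family is indexed by [nat] with a bound [n], so that partial sums can be
    formed without reindexing. Sets [A i] may be chosen equal to [setT], hence
    the product rule for the full family contains that for its subfamilies. *)
Definition mutually_independent d (T : measurableType d) (R : realType)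
    (P : probability T R) (n : nat) (Y : nat -> T -> R) :=
  forall A : nat -> set R, (forall i, measurable (A i)) ->
  P [set x | forall i, (i < n)%N -> A i (Y i x)] =
  (\prod_(i < n) P (Y i @^-1` A i))%E.

Definition independent2 d (T : measurableType d) (R : realType)
    (P : probability T R) (U V : T -> R) :=
  forall A B, measurable A -> measurable B ->
  P ((U @^-1` A) `&` (V @^-1` B)) = (P (U @^-1` A) * P (V @^-1` B))%E.

Section independence.
Context d (T : measurableType d) (R : realType) (P : probability T R).
Implicit Types (Y : nat -> {mfun T >-> R}) (U V : {mfun T >-> R}).

(** The joint law of [(U, V)] agrees with the product of the laws on rectangles,
    and these determine a product of sigma-finite measures. *)
Lemma integral_independent2 U V (h : R * R -> \bar R) :
  independent2 P U V -> measurable_fun setT h -> (forall z, 0 <= h z)%E ->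
  (\int[P]_x h (U x, V x) =
   \int[distribution P U \x distribution P V]_z h z)%E.
Proof.
move=> UV mh h0.
have mUV : measurable_fun setT (fun x => (U x, V x)).
  exact: measurable_fun_pair.
transitivity (\int[pushforward P (fun x => (U x, V x))]_z h z)%E.
  by rewrite ge0_integral_pushforward.
apply: eq_measure_integral => A mA _; apply/esym.
apply: product_measure_unique => // B C mB mC.
Qed.

(** Restricting [P] to [C] and dividing by [P C] gives a measure on the plane
    with the rectangle values of the product law; when [P C = 0] both sides
    vanish. *)
Lemma product_law_restricted U V (C : set T) : measurable C ->
  (forall A B, measurable A -> measurable B ->
    P ((U @^-1` A `&` V @^-1` B) `&` C) =
    (P (U @^-1` A) * P (V @^-1` B) * P C)%E) ->
  forall X : set (R * R), measurable X ->
    P ((fun x => (U x, V x)) @^-1` X `&` C) =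
    ((distribution P U \x distribution P V) X * P C)%E.
Proof.
move=> mC UVC X mX.
have mUV : measurable_fun setT (fun x => (U x, V x)).
  exact: measurable_fun_pair.
have mUVX : measurable ((fun x => (U x, V x)) @^-1` X).
  by rewrite -[_ @^-1` _]setTI; exact: mUV.
have PCfin : P C \is a fin_num by exact: fin_num_measure.
have [PC0|PC0] := eqVneq (P C) 0%E.
  rewrite PC0 mule0; apply/eqP; rewrite eq_le measure_ge0 andbT -PC0.
  by apply: le_measure; rewrite ?inE//; exact: measurableI.
have c0 : 0 < fine (P C).
  by rewrite fine_gt0// lt0e PC0 measure_ge0/= ltey_eq PCfin.
have ci0 : 0 <= (fine (P C))^-1 by rewrite invr_ge0 ltW.
have cC : (((fine (P C))^-1)%:E * P C = 1)%E.
  by rewrite -[X in (_ * X)%E]fineK// -EFinM mulVf ?gt_eqF.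
pose m' : {measure set (R * R) -> \bar R} :=
  mscale (NngNum ci0) (pushforward (mrestr P mC) (fun x => (U x, V x))).
rewrite (@product_measure_unique _ _ _ _ _ _ _ (m' mUV))//.
  by rewrite /m' /mscale/= /pushforward/= /mrestr muleAC cC mul1e.
move=> A B mA mB.
rewrite /m' /mscale/= /pushforward/= /mrestr.
transitivity (((fine (P C))^-1)%:E * P ((U @^-1` A `&` V @^-1` B) `&` C))%E; first by [].
by rewrite UVC// muleCA cC mule1.
Qed.

(** Replaces the first two variables by their sum; iterating it turns a partial
    sum into the first member of an independent family. *)
Definition merge_head Y (i : nat) : {mfun T >-> R} :=
  if i is 0%N then (Y 0%N + Y 1%N)%R else Y i.+1.

Lemma sum_merge_head Y n :
  \sum_(i < n.+1) merge_head Y i = \sum_(i < n.+2) Y i.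
Proof.
by rewrite big_ord_recl 2![in RHS]big_ord_recl addrA.
Qed.

(** Under the conditions put on the later variables, the pair formed by the
    first two still has a product law, which determines the law of its sum. *)
Lemma mutually_independent_merge_head Y n :
  mutually_independent P n.+2 Y -> mutually_independent P n.+1 (merge_head Y).
Proof.
move=> iY A mA.
have mY (i : nat) (B : set R) : measurable B -> measurable (Y i @^-1` B).
  by move=> mB; exact: measurable_funPTI.
pose C := [set x | forall i, (i < n)%N -> A i.+1 (Y i.+2 x)].
pose Z B0 B1 C (i : nat) : set R :=
  if i is i'.+1 then if i' is i''.+1 then C i''.+1 else B1 else B0.
have mZ (B0 B1 : set R) D : measurable B0 -> measurable B1 ->
    (forall i, measurable (D i)) -> forall i, measurable (Z B0 B1 D i).
  by move=> mB0 mB1 mD; case=> [|[|i]] /=.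
have ZE (B0 B1 : set R) D : [set x | forall i, (i < n.+2)%N -> Z B0 B1 D i (Y i x)] =
    (Y 0%N @^-1` B0 `&` Y 1%N @^-1` B1) `&`
    [set x | forall i, (i < n)%N -> D i.+1 (Y i.+2 x)].
  apply/seteqP; split=> [x h|x [[h0 h1] h]].
    split; first by split; [exact: (h 0%N)|exact: (h 1%N)].
    by move=> i ilt; exact: (h i.+2).
  by move=> [_//|[_//|i]] /=; rewrite !ltnS; exact: h.
have Yprod (B0 B1 : set R) D : measurable B0 -> measurable B1 ->
    (forall i, measurable (D i)) ->
    P ((Y 0%N @^-1` B0 `&` Y 1%N @^-1` B1) `&`
       [set x | forall i, (i < n)%N -> D i.+1 (Y i.+2 x)]) =
    (P (Y 0%N @^-1` B0) * P (Y 1%N @^-1` B1) *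
      \prod_(i < n) P (Y i.+2 @^-1` D i.+1))%E.
  move=> mB0 mB1 mD; rewrite -ZE iY; last exact: mZ.
  by rewrite 2!big_ord_recl/= muleA.
have PC D : (forall i, measurable (D i)) ->
    P [set x | forall i, (i < n)%N -> D i.+1 (Y i.+2 x)] =
    (\prod_(i < n) P (Y i.+2 @^-1` D i.+1))%E.
  move=> mD; have := Yprod setT setT D measurableT measurableT mD.
  by rewrite !preimage_setT !setTI probability_setT !mul1e.
have mC D : (forall i, measurable (D i)) ->
    measurable [set x | forall i, (i < n)%N -> D i.+1 (Y i.+2 x)].
  move=> mD; rewrite [X in measurable X](_ : _ =
      \bigcap_(i in [set i | (i < n)%N]) (Y i.+2 @^-1` D i.+1)).
    by apply: bigcap_measurableType => i _; exact: mY.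
  by apply/seteqP; split.
have key D : (forall i, measurable (D i)) ->
    P ((merge_head Y 0 @^-1` A 0%N) `&`
       [set x | forall i, (i < n)%N -> D i.+1 (Y i.+2 x)]) =
    ((distribution P (Y 0%N) \x distribution P (Y 1%N))
       [set z : R * R | A 0%N (z.1 + z.2)%R] *
     P [set x | forall i, (i < n)%N -> D i.+1 (Y i.+2 x)])%E.
  move=> mD; rewrite -product_law_restricted//.
  - exact: mC.
  - by move=> B0 B1 mB0 mB1; rewrite Yprod// PC.
  - have mD2 : measurable_fun setT (fun z : R * R => z.1 + z.2).
      exact: measurable_funD.
    by rewrite -[X in measurable X]setTI; exact: mD2.
rewrite big_ord_recl/=.
rewrite [X in P X](_ : _ = (merge_head Y 0 @^-1` A 0%N) `&`
   [set x | forall i, (i < n)%N -> A i.+1 (Y i.+2 x)]); last first.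
  apply/seteqP; split=> [x h|x [h0 h]].
    by split; [exact: (h 0%N)|move=> i ilt; exact: (h i.+1)].
  by case=> [_|i]; [exact: h0|rewrite ltnS; exact: h].
rewrite key// PC//; congr (_ * _)%E.
have := key (fun=> setT) (fun=> measurableT).
rewrite (_ : [set x | _] = setT); last by apply/seteqP; split.
by rewrite setIT probability_setT mule1 => <-.
Qed.

Lemma independent_sum_last Y n : mutually_independent P n.+1 Y ->
  independent2 P (\sum_(i < n) Y i) (Y n).
Proof.
elim: n Y => [|[|n] ih] Y iY A B mA mB.
- rewrite big_ord0.
  have -> : (0 : {mfun T >-> R}) @^-1` A = if 0 \in A then setT else set0.
    by case: ifPn => [/set_mem A0|/negP A0]; apply/seteqP; split => x //=;
      rewrite -?[X in A X]/0 => ? ; apply: A0; apply/mem_set.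
  case: ifPn => _; first by rewrite setTI probability_setT mul1e.
  by rewrite set0I measure0 mul0e.
- rewrite big_ord1.
  have := iY (fun i => if i is 0%N then A else B).
  rewrite 2!big_ord_recl big_ord0 mule1 => <-; last by case.
  congr (P _); apply/seteqP; split=> [x [hA hB] [|[|]]//|x h].
  by split; [exact: (h 0%N)|exact: (h 1%N)].
- rewrite -sum_merge_head; apply: (ih (merge_head Y)) => //.
  exact: mutually_independent_merge_head.
Qed.
End independence.

(** * Expectations of bounded random variables *)

Section bounded_expectation.
Context d (T : measurableType d) (R : realType) (P : probability T R).

(** Real-valued expectation; it is only used for bounded variables, for which
    no integrability condition is needed. *)
Definition Er (X : T -> R) : R := (\int[P]_x X x)%R.

Definition bounded_rv (X : T -> R) :=
  measurable_fun setT X /\ exists c : R, forall x, `|X x| <= c.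

Lemma bounded_rv_integrable (X : T -> R) :
  bounded_rv X -> P.-integrable setT (EFin \o X).
Proof.
move=> [mX [c Xc]]; apply: measurable_bounded_integrable => //.
  by rewrite (le_lt_trans (probability_le1 _ _))// ltry.
exists c; split=> [|M cM]; first exact: num_real.
by move=> x _ /=; rewrite (le_trans (Xc x)) ?ltW.
Qed.

Lemma ErE (X : T -> R) : bounded_rv X -> (\int[P]_x (X x)%:E)%E = (Er X)%:E.
Proof.
move=> bX; rewrite /Er /Rintegral fineK//.
exact/integrable_fin_num/bounded_rv_integrable.
Qed.

Lemma bounded_rv_cst c : bounded_rv (fun=> c).
Proof. by split; [exact: measurable_cst|exists `|c|]. Qed.

Lemma bounded_rvD X Y : bounded_rv X -> bounded_rv Y ->
  bounded_rv (fun x => X x + Y x).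
Proof.
move=> [mX [c Xc]] [mY [e Ye]]; split; first exact: measurable_funD.
by exists (c + e) => x; rewrite (le_trans (ler_normD _ _))// lerD.
Qed.

Lemma bounded_rvM X Y : bounded_rv X -> bounded_rv Y ->
  bounded_rv (fun x => X x * Y x).
Proof.
move=> [mX [c Xc]] [mY [e Ye]]; split; first exact: measurable_funM.
by exists (c * e) => x; rewrite normrM ler_pM.
Qed.

Lemma bounded_rvX X n : bounded_rv X -> bounded_rv (fun x => X x ^+ n).
Proof.
move=> bX; elim: n => [|n ih]; first exact: bounded_rv_cst.
by under eq_fun do rewrite exprS; exact: bounded_rvM.
Qed.

Lemma bounded_rv_sum n (X : nat -> T -> R) : (forall i, bounded_rv (X i)) ->
  bounded_rv (fun x => \sum_(i < n) X i x).
Proof.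
move=> bX; elim: n => [|n ih].
  by under eq_fun do rewrite big_ord0; exact: bounded_rv_cst.
by under eq_fun do rewrite big_ord_recr/=; exact: bounded_rvD.
Qed.

Lemma bounded_rv_abs X : bounded_rv X -> bounded_rv (fun x => `|X x|).
Proof.
move=> [mX [c Xc]]; split; first exact: measurableT_comp.
by exists c => x; rewrite normr_id.
Qed.

Lemma Er_cst c : Er (fun=> c) = c.
Proof.
by rewrite /Er Rintegral_cst//= [X in fine X]probability_setT mulr1.
Qed.

Lemma ErD X Y : bounded_rv X -> bounded_rv Y ->
  Er (fun x => X x + Y x) = Er X + Er Y.
Proof. by move=> bX bY; rewrite /Er RintegralD//; exact: bounded_rv_integrable. Qed.

Lemma ErZ c X : bounded_rv X -> Er (fun x => c * X x) = c * Er X.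
Proof. by move=> bX; rewrite /Er RintegralZl//; exact: bounded_rv_integrable. Qed.

Lemma Er_le X Y : bounded_rv X -> bounded_rv Y -> (forall x, X x <= Y x) ->
  Er X <= Er Y.
Proof.
move=> bX bY XY; rewrite /Er le_Rintegral//; exact: bounded_rv_integrable.
Qed.

Lemma Er_ge0 X : (forall x, 0 <= X x) -> 0 <= Er X.
Proof. by move=> X0; rewrite /Er Rintegral_ge0. Qed.

Lemma Er_sum n (X : nat -> T -> R) : (forall i, bounded_rv (X i)) ->
  Er (fun x => \sum_(i < n) X i x) = \sum_(i < n) Er (X i).
Proof.
move=> bX; elim: n => [|n ih].
  by under eq_fun do rewrite big_ord0; rewrite big_ord0 Er_cst.
under eq_fun do rewrite big_ord_recr/=.
by rewrite big_ord_recr/= ErD ?ih//; exact: bounded_rv_sum.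
Qed.

(** Fubini for the product law on the plane. *)
Lemma Er_mul_independent2 X Y : bounded_rv X -> bounded_rv Y ->
  independent2 P X Y -> Er (fun x => X x * Y x) = Er X * Er Y.
Proof.
move=> bX bY XY.
have [mX [c Xc]] := bX; have [mY [e Ye]] := bY.
pose U : {mfun T >-> R} := HB.pack X (isMeasurableFun.Build _ _ _ _ _ mX).
pose V : {mfun T >-> R} := HB.pack Y (isMeasurableFun.Build _ _ _ _ _ mY).
have mUV : measurable_fun setT (fun x => (U x, V x)).
  exact: measurable_fun_pair.
pose h (z : R * R) : \bar R := (z.1 * z.2)%:E.
have mh : measurable_fun setT h by apply/measurable_EFinP; exact: measurable_funM.
have ih : P.-integrable setT (h \o (fun x => (U x, V x))).
  exact: (bounded_rv_integrable (bounded_rvM bX bY)).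
have eqm : forall A, measurable A -> A `<=` setT ->
    (distribution P U \x distribution P V)%E A =
    pushforward P (fun x => (U x, V x)) A.
  by move=> A mA _; exact: product_measure_unique.
have ihp : (distribution P U \x distribution P V)%E.-integrable setT h.
  have /integrableP[_ hoo] : (pushforward P (fun x => (U x, V x))).-integrable setT h.
    exact: integrable_pushforward.
  apply/integrableP; split=> //.
  rewrite (eq_measure_integral (pushforward P (fun x => (U x, V x))))//.
have EE (W : {mfun T >-> R}) : bounded_rv W ->
    (\int[distribution P W]_y y%:E)%E = (Er W)%:E.
  move=> bW; rewrite integral_distribution//; first exact: ErE.
  exact: bounded_rv_integrable.
have iE (W : {mfun T >-> R}) : bounded_rv W ->
    (distribution P W).-integrable setT (fun y : R => y%:E).
  move=> bW; apply: integrable_pushforward => //.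
    by apply/measurable_EFinP; exact: measurable_id.
  exact: bounded_rv_integrable bW.
apply: EFin_inj; rewrite -ErE; last exact: bounded_rvM.
transitivity (\int[pushforward P (fun x => (U x, V x))]_z h z)%E.
  by rewrite integral_pushforward.
rewrite (eq_measure_integral (distribution P U \x distribution P V)%E); last first.
  by move=> A mA AT; exact/esym/eqm.
rewrite -integral12_prod_meas1//.
transitivity (\int[distribution P U]_u (u%:E * (Er V)%:E))%E.
  apply: eq_integral => u _; rewrite /fubini_F -EE//.
  rewrite -integralZl//; last exact: iE.
by rewrite integralZr// ?EE//; exact: iE.
Qed.

End bounded_expectation.

(** * Moments of sums of independent variables *)

Section partial_sums.
Context d (T : measurableType d) (R : realType) (P : probability T R).
Implicit Types (Y : nat -> {mfun T >-> R}).

Lemma mutually_independent_le Y n k : (k <= n)%N ->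
  mutually_independent P n Y -> mutually_independent P k Y.
Proof.
move=> kn iY A mA.
pose A' i := if (i < k)%N then A i else setT.
have mA' i : measurable (A' i) by rewrite /A'; case: ifP.
have := iY A' mA'.
rewrite (_ : [set x | _] = [set x | forall i, (i < k)%N -> A i (Y i x)]); last first.
  apply/seteqP; split=> x h i ik; rewrite /A'.
    by have := h i (leq_trans ik kn); rewrite /A' ik.
  by case: ifP => // /h.
move=> ->; rewrite (big_ord_widen_cond n xpredT (fun i => P (Y i @^-1` A i)))//.
rewrite [RHS]big_mkcond/=; apply: eq_bigr => i _; rewrite /A'.
by case: ifP => //; rewrite preimage_setT probability_setT.
Qed.

Lemma independent_partial_sum Y n k : (k < n)%N ->
  mutually_independent P n Y ->
  independent2 P (fun x => \sum_(i < k) Y i x) (Y k).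
Proof.
move=> kn /(mutually_independent_le kn)/independent_sum_last.
by under [X in _ -> independent2 _ X _]eq_fun do rewrite -mfun_sum.
Qed.

Lemma independent2_comp (U V : T -> R) (f g : R -> R) :
  measurable_fun setT f -> measurable_fun setT g ->
  independent2 P U V -> independent2 P (f \o U) (g \o V).
Proof.
move=> mf mg UV A B mA mB; apply: (UV (f @^-1` A) (g @^-1` B)).
  by rewrite -[_ @^-1` _]setTI; exact: mf.
by rewrite -[_ @^-1` _]setTI; exact: mg.
Qed.

End partial_sums.

Section real_inequalities.
Context (R : realType).
Implicit Types u y : R.

(** Compare the exponential series term by term: [|y| <= 1] makes
    [(u y)^k <= y^2 u^k] for [k >= 2]. *)
Lemma expR_le_quadratic u y : 0 <= u -> `|y| <= 1 ->
  expR (u * y) <= 1 + u * y + y ^+ 2 * (expR u - 1 - u).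
Proof.
move=> u0 y1.
pose s := fun N => \sum_(0 <= k < N) (y ^+ 2 * exp_coeff u k - exp_coeff (u * y) k).
have sE : s = (fun N => y ^+ 2 * series (exp_coeff u) N
                        - series (exp_coeff (u * y)) N).
  by apply/funext => N; rewrite /s /series/= mulr_sumr sumrB.
have scvg : s @ \oo --> y ^+ 2 * expR u - expR (u * y).
  rewrite sE; apply: cvgB; last exact: is_cvg_series_exp_coeff.
  by apply: cvgMr; exact: is_cvg_series_exp_coeff.
have y2 k : `|y| ^+ k.+2 <= y ^+ 2.
  by rewrite -[leRHS]real_normK ?num_real// -addn2 exprD ler_piMl ?exprn_ge0// exprn_ile1.
have : y ^+ 2 * (1 + u) - (1 + u * y) <= limn s.
  apply: limr_ge; first by apply/cvg_ex; eexists; exact: scvg.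
  exists 2%N => // -[|[|N]]// _.
  rewrite /s big_nat_recl// big_nat_recl//= /exp_coeff/= !expr0 !expr1.
  rewrite fact0 invr1.
  have : 0 <= \sum_(0 <= i < N) (y ^+ 2 * (u ^+ i.+2 / (i.+2)`!%:R)
      - (u * y) ^+ i.+2 / (i.+2)`!%:R).
    apply: sumr_ge0 => i _; rewrite mulrA -mulrBl divr_ge0 ?ler0n//.
    rewrite exprMn mulrC -mulrBr mulr_ge0 ?exprn_ge0// subr_ge0.
    by rewrite (le_trans (ler_norm _))// normrX.
  rewrite !mulr1 mulrDr mulr1; lra.
rewrite (cvg_lim _ scvg)//; lra.
Qed.

(** One of [y^2 <= r |y|] and [r^2 <= y^2] holds. Integrating it bounds a second
    moment by a first and a fourth moment, in place of Hoelder's inequality. *)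
Lemma sqr_le_norm_add_pow4 r y : 0 <= r ->
  r ^+ 2 * y ^+ 2 <= r ^+ 3 * `|y| + y ^+ 4.
Proof.
move=> r0; rewrite -[y ^+ 2]real_normK ?num_real//.
rewrite (_ : y ^+ 4 = `|y| ^+ 4); last first.
  by rewrite (exprM y 2 2) -[y ^+ 2]real_normK ?num_real// -exprM.
have w0 := normr_ge0 y; set w := `|y| in w0 *.
have [wr|rw] := leP w r.
  have : 0 <= r ^+ 2 * w * (r - w) by rewrite !mulr_ge0// ?sqr_ge0// subr_ge0.
  have := exprn_ge0 4 w0; nra.
have : 0 <= w ^+ 2 * ((w - r) * (w + r)).
  by rewrite mulr_ge0 ?sqr_ge0// mulr_ge0 ?subr_ge0 ?(ltW rw)// addr_ge0.
have : 0 <= r ^+ 3 * w by rewrite mulr_ge0// exprn_ge0.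
nra.
Qed.

Lemma le_add_of_scaled (r e c : R) : 0 <= c -> 0 <= e ->
  0 <= 27 * e - 5 * r -> r <= c + 6 * e.
Proof. by lra. Qed.

(** A crude form of Stirling's formula: [n! e^(n-1) <= n^(n+1)]. The induction
    step is [(1 + 1/n)^(n+1) >= e]. *)
Lemma fact_expR_le n :
  n.+1`!%:R * expR n%:R <= n.+1%:R ^+ n.+2 :> R.
Proof.
elim: n => [|n ih]; first by rewrite expR0 mulr1 expr1n.
have e1 : expR 1 * n.+1%:R ^+ n.+2 <= n.+2%:R ^+ n.+2 :> R.
  have : (n.+1%:R / n.+2%:R) ^+ n.+2 <= expR (- 1) :> R.
    have -> : -1 = - n.+2%:R^-1 * n.+2%:R :> R by rewrite mulNr mulVf.
    rewrite expRM_natr lerXn2r ?nnegrE ?expR_ge0 ?divr_ge0 ?ler0n//.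
    rewrite (le_trans _ (expR_ge1Dx _))// lerBrDr.
    by rewrite -[X in _ + X]div1r -mulrDl -natr1 ?natr1 divff.
  rewrite expr_div_n ler_pdivrMr ?exprn_gt0// expRN.
  by rewrite ler_pdivlMl ?expR_gt0.
rewrite factS natrM -[X in expR X]natr1 expRD [leRHS]exprS -mulrA.
rewrite ler_wpM2l ?ler0n// mulrA (le_trans _ e1)// mulrC.
by rewrite ler_wpM2l ?expR_ge0.
Qed.

End real_inequalities.

Section moments.
Context d (T : measurableType d) (R : realType) (P : probability T R).
Variables (Y : nat -> {mfun T >-> R}) (n : nat) (c : R).
Hypothesis iY : mutually_independent P n Y.
Hypothesis c0 : 0 <= c.
Hypothesis Yc : forall i x, `|Y i x| <= c.
Hypothesis Y0 : forall i, Er P (Y i) = 0.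

Let U k x := \sum_(i < k) Y i x.
Let s k := \sum_(i < k) Er P (fun x => Y i x ^+ 2).

Let bY i : bounded_rv (Y i).
Proof. by split; [exact: measurable_funP|exists c => x; exact: Yc]. Qed.

Let bU k : bounded_rv (U k).
Proof. exact: (@bounded_rv_sum _ _ _ k (fun i => Y i) bY). Qed.

Let US k x : U k.+1 x = U k x + Y k x.
Proof. by rewrite /U big_ord_recr. Qed.

Let UY k a b : (k < n)%N ->
  Er P (fun x => U k x ^+ a * Y k x ^+ b) =
  Er P (fun x => U k x ^+ a) * Er P (fun x => Y k x ^+ b).
Proof.
move=> kn; apply: Er_mul_independent2; try exact: bounded_rvX.
apply: (@independent2_comp _ _ _ P (U k) (Y k) (fun x => x ^+ a) (fun x => x ^+ b)) => //.
exact: independent_partial_sum iY.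
Qed.

Lemma Er_partial_sum k : Er P (fun x => \sum_(i < k) Y i x) = 0.
Proof. by rewrite (@Er_sum _ _ _ P k (fun i => Y i))// big1. Qed.

Lemma Er_sqr_partial_sum k : (k <= n)%N -> Er P (fun x => U k x ^+ 2) = s k.
Proof.
elim: k => [_|k ih kn].
  rewrite /s big_ord0 -[RHS](Er_cst P); congr Er.
  by apply/funext => x; rewrite /U big_ord0 expr0n.
rewrite (_ : (fun x => _) = (fun x => U k x ^+ 2 + (2 * (U k x ^+ 1 * Y k x ^+ 1)
    + Y k x ^+ 2))); last by apply/funext => x; rewrite US; ring.
have b2 := bounded_rvX 2 (bU k); have b2' := bounded_rvX 2 (bY k).
have b3 := bounded_rvM (bounded_rvX 1 (bU k)) (bounded_rvX 1 (bY k)).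
have b4 := bounded_rvM (bounded_rv_cst T 2) b3.
rewrite ErD ?ErD ?ErZ//; last exact: bounded_rvD.
rewrite UY// (_ : Er P (fun x => Y k x ^+ 1) = 0) ?mulr0 ?add0r; last exact: Y0.
by rewrite ih ?(ltnW kn)// /s big_ord_recr.
Qed.

Lemma sum_variances_ge0 k : 0 <= s k.
Proof. by apply: sumr_ge0 => i _; apply: Er_ge0 => x; exact: sqr_ge0. Qed.

(** Expanding the fourth power of [U_k + Y_k], the terms with an odd power of
    either factor equal to one vanish, so that each step adds
    [6 E U_k^2 E Y_k^2 + E Y_k^4]. *)
Lemma Er_pow4_partial_sum k : (k <= n)%N ->
  Er P (fun x => U k x ^+ 4) <= 3 * s k ^+ 2 + c ^+ 2 * s k.
Proof.
elim: k => [_|k ih kn].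
  rewrite /s big_ord0 expr0n !mulr0 addr0 -[leRHS](Er_cst P).
  by under eq_fun do rewrite /U big_ord0 expr0n.
rewrite (_ : (fun x => _) = (fun x => U k x ^+ 4 + (4 * (U k x ^+ 3 * Y k x ^+ 1)
    + (6 * (U k x ^+ 2 * Y k x ^+ 2) + (4 * (U k x ^+ 1 * Y k x ^+ 3)
    + Y k x ^+ 4))))); last by apply/funext => x; rewrite US; ring.
have bX a := bounded_rvX a (bU k); have bZ b := bounded_rvX b (bY k).
have bM a b := bounded_rvM (bX a) (bZ b).
have bC e a b := bounded_rvM (bounded_rv_cst T e) (bM a b).
rewrite !ErD ?ErZ//; do ?[exact: bounded_rvD | apply: bounded_rvD => //].
rewrite !UY// (_ : Er P (fun x => Y k x ^+ 1) = 0); last exact: Y0.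
rewrite (_ : Er P (fun x => U k x ^+ 1) = 0); last exact: Er_partial_sum.
rewrite Er_sqr_partial_sum ?(ltnW kn)//.
have Y4 : Er P (fun x => Y k x ^+ 4) <= c ^+ 2 * Er P (fun x => Y k x ^+ 2).
  rewrite -ErZ//; apply: Er_le => //.
    exact: bounded_rvM (bounded_rv_cst _ _) _.
  move=> x; rewrite (exprD _ 2 2) ler_wpM2r ?sqr_ge0//.
  by rewrite -[leLHS]real_normK ?num_real// lerXn2r ?nnegrE// Yc.
have := ih (ltnW kn).
rewrite /s big_ord_recr/= -/(s k).
have : 0 <= Er P (fun x => Y k x ^+ 2) by apply: Er_ge0 => x; exact: sqr_ge0.
move: Y4; set v := Er P (fun x => Y k x ^+ 2); set w := Er _ _; set z := Er _ _.
set c2 := c ^+ 2; set t := s k => Y4 v0 IH; rewrite !mul0r !mulr0 add0r.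
have : 0 <= v ^+ 2 by exact: sqr_ge0.
lra.
Qed.

(** A converse to the inequality between the first and the second moment. Unless
    the variance is below [c ^ 2], the fourth moment is at most four times
    its square, and [sqr_le_norm_add_pow4] with [r] three times the standard
    deviation [sigma] gives [5 sigma <= 27 E|U|]. *)
Lemma variance_le k : (k <= n)%N ->
  s k <= (c + 6 * Er P (fun x => `|\sum_(i < k) Y i x|)) ^+ 2.
Proof.
move=> kn; set e := Er _ _.
have e0 : 0 <= e by exact: Er_ge0.
have [sc|cs] := leP (s k) (c ^+ 2).
  by rewrite (le_trans sc)// lerXn2r ?nnegrE ?addr_ge0 ?mulr_ge0// lerDl mulr_ge0.
pose r : R := Num.sqrt (s k).
have r2 : r ^+ 2 = s k by rewrite sqr_sqrtr// sum_variances_ge0.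
have r0 : 0 < r by rewrite sqrtr_gt0 (le_lt_trans _ cs)// sqr_ge0.
have bU2 := bounded_rvX 2 (bU k); have bU4 := bounded_rvX 4 (bU k).
have bUa := bounded_rv_abs (bU k).
have : Er P (fun x => (3 * r) ^+ 2 * U k x ^+ 2) <=
       Er P (fun x => (3 * r) ^+ 3 * `|U k x| + U k x ^+ 4).
  apply: Er_le.
  - exact: bounded_rvM (bounded_rv_cst _ _) _.
  - by apply: bounded_rvD => //; exact: bounded_rvM (bounded_rv_cst _ _) _.
  - by move=> x; rewrite sqr_le_norm_add_pow4// mulr_ge0// ltW.
rewrite ErD//; last exact: bounded_rvM (bounded_rv_cst _ _) _.
rewrite !ErZ// Er_sqr_partial_sum// -r2 -/e => h.
have h4 := Er_pow4_partial_sum kn.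
have {h4} h4 : Er P (fun x => U k x ^+ 4) <= 4 * r ^+ 4.
  rewrite (le_trans h4)// -r2 (_ : 4 * r ^+ 4 = 3 * (r ^+ 2) ^+ 2 + r ^+ 2 * r ^+ 2); last by ring.
  by rewrite lerD2l ler_wpM2r ?sqr_ge0// r2 ltW.
have {h h4} : 0 <= r ^+ 3 * (27 * e - 5 * r).
  move: h h4; set z := Er _ _ => h h4; nra.
rewrite pmulr_rge0 ?exprn_gt0// => re.
have rce : r <= c + 6 * e by exact: le_add_of_scaled.
by rewrite lerXn2r ?nnegrE ?(ltW r0) ?addr_ge0 ?mulr_ge0//.
Qed.

(** Each factor satisfies [E e^(u Y) <= 1 + v (e^u - 1 - u)], where [v] is its
    variance. The bound is the moment generating function of a centred Poisson
    variable whose parameter is the variance of the sum. *)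
Lemma mgf_partial_sum u k : c = 1 -> 0 <= u -> (k <= n)%N ->
  Er P (fun x => expR (u * \sum_(i < k) Y i x)) <= expR ((expR u - 1 - u) * s k).
Proof.
move=> c1 u0; set g := expR u - 1 - u.
have bE V : bounded_rv V -> bounded_rv (fun x => expR (u * V x)).
  move=> [mV [e Ve]]; split.
    by apply: measurableT_comp; [exact: measurable_expR|exact: measurable_funM].
  exists (expR (u * e)) => x; rewrite ger0_norm ?expR_ge0// ler_expR ler_wpM2l//.
  exact: le_trans (ler_norm _) (Ve x).
elim: k => [_|k ih kn].
  rewrite /s big_ord0 mulr0 expR0 -[leRHS](Er_cst P).
  by under eq_fun do rewrite big_ord0 mulr0 expR0.
rewrite (_ : (fun x => _) = (fun x => expR (u * U k x) * expR (u * Y k x))); last first.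
  by apply/funext => x; rewrite big_ord_recr/= mulrDr expRD.
rewrite Er_mul_independent2; [|exact: bE|exact: bE|]; last first.
  apply: (@independent2_comp _ _ _ P (U k) (Y k) (fun x => expR (u * x)) (fun x => expR (u * x))).
  - by apply: measurableT_comp; [exact: measurable_expR|exact: mulrl_measurable].
  - by apply: measurableT_comp; [exact: measurable_expR|exact: mulrl_measurable].
  - exact: independent_partial_sum iY.
rewrite [s k.+1]big_ord_recr/= -/(s k) mulrDr expRD.
rewrite ler_pM ?ih ?(ltnW kn)//; [exact: Er_ge0 (fun=> expR_ge0 _)|exact: Er_ge0 (fun=> expR_ge0 _)|].
apply: le_trans (expR_ge1Dx _).
have b2 := bounded_rvX 2 (bY k).
have bM e V : bounded_rv V -> bounded_rv (fun x : T => e * V x).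
  exact: bounded_rvM (bounded_rv_cst _ _).
rewrite -ErZ// -[X in _ <= X + _](Er_cst P) -[X in _ <= _ + X]add0r -[X in _ + (X + _)](mulr0 u).
rewrite -(Y0 k) -ErZ// -ErD//; [|exact: bM..].
rewrite -ErD//; [|exact: bounded_rv_cst|by apply: bounded_rvD; exact: bM].
apply: Er_le; first exact: bE.
  apply: bounded_rvD; first exact: bounded_rv_cst.
  by apply: bounded_rvD; exact: bM.
move=> x; rewrite addrA (mulrC g) expR_le_quadratic// -c1; exact: Yc.
Qed.

End moments.

(** * A Poisson tail bound for centred sums *)

Section bennett.
Context d (T : measurableType d) (R : realType) (P : probability T R).
Implicit Types (V : nat -> {mfun T >-> R}).

Lemma Er_indic (A : set T) : measurable A -> Er P \1_A = fine (P A).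
Proof. by move=> mA; rewrite /Er /Rintegral integral_indic// setIT. Qed.

(** Markov's inequality for [expR (u * _)] with [u = ln m.+1], which is the optimal
    choice for a Poisson(1) variable. *)
Lemma upper_tail_le_invfact V n m :
  mutually_independent P n V -> (forall i x, `|V i x| <= 1) ->
  (forall i, Er P (V i) = 0) ->
  \sum_(i < n) Er P (fun x => V i x ^+ 2) <= 1 ->
  (P [set x | (m.+1%:R <= \sum_(i < n) V i x)%R] <= (m.+1`!%:R^-1)%:E)%E.
Proof.
move=> iV V1 V0 Vs.
have mU : measurable_fun setT (fun x => \sum_(i < n) V i x).
  by apply: measurable_sum => i; exact: measurable_funP.
set A := [set x | _].
have mA : measurable A.
  rewrite (_ : A = (fun x => \sum_(i < n) V i x) @^-1` `[m.+1%:R, +oo[).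
    by rewrite -[_ @^-1` _]setTI; apply: mU.
  by apply/seteqP; split=> x /=; rewrite in_itv/= andbT.
have PAfin : P A \is a fin_num by exact: fin_num_measure.
rewrite -(fineK PAfin) lee_fin -Er_indic//.
pose u : R := ln m.+1%:R.
have m0 : 0 < m.+1%:R :> R by [].
have u0 : 0 <= u by rewrite ln_ge0// ler1n.
have eu : expR u = m.+1%:R by rewrite lnK.
have bV i : bounded_rv (V i) by split; [exact: measurable_funP|exists 1].
have bU : bounded_rv (fun x => \sum_(i < n) V i x).
  exact: (@bounded_rv_sum _ _ _ n (fun i => V i) bV).
have bE : bounded_rv (fun x => expR (u * \sum_(i < n) V i x)).
  have [mU' [c Uc]] := bU; split.
    apply: measurableT_comp; first exact: measurable_expR.
    exact: measurable_funM.
  exists (expR (u * c)) => x; rewrite ger0_norm ?expR_ge0// ler_expR ler_wpM2l//.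
  exact: le_trans (ler_norm _) (Uc x).
have bA : bounded_rv (\1_A : T -> R).
  split; first exact: measurable_indic.
  by exists 1 => x; rewrite indicE; case: (_ \in _); rewrite ?normr1 ?normr0.
have markov : m.+1%:R ^+ m.+1 * Er P \1_A <=
    Er P (fun x => expR (u * \sum_(i < n) V i x)).
  rewrite -ErZ//; apply: Er_le => //.
    by apply: bounded_rvM => //; exact: bounded_rv_cst.
  move=> x; rewrite indicE; have [xA|_] := boolP (x \in A); last by rewrite mulr0 expR_ge0.
  rewrite mulr1 -eu -expRM_natr ler_expR ler_wpM2l//.
  exact: set_mem xA.
have := mgf_partial_sum iV V1 V0 (erefl 1) u0 (leqnn n).
set s := \sum_(i < n) _ => mgf.
have g0 : 0 <= expR u - 1 - u by have := expR_ge1Dx u; lra.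
have {}mgf : m.+1%:R ^+ m.+1 * Er P \1_A <= expR m%:R / m.+1%:R.
  rewrite (le_trans markov)// (le_trans mgf)//.
  rewrite -[X in _ / X]eu -expRB ler_expR (_ : m%:R = expR u - 1); last first.
    by rewrite eu -[m.+1%:R]natr1 addrK.
  by rewrite -[leRHS]mulr1 ler_wpM2l.
have fe := fact_expR_le R m.
rewrite -div1r ler_pdivlMr ?ltr0n ?fact_gt0//.
move: mgf; rewrite ler_pdivlMr// => mgf.
have p0 : 0 < m.+1%:R ^+ m.+2 :> R by rewrite exprn_gt0.
rewrite -(ler_pM2r p0) mul1r (le_trans _ fe)//.
rewrite [_ * m.+1`!%:R]mulrC -mulrA ler_wpM2l//.
by rewrite (le_trans _ mgf)// exprSr mulrA (mulrC (Er _ _)).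
Qed.

Lemma two_sided_tail_le_invfact V n m :
  mutually_independent P n V -> (forall i x, `|V i x| <= 1) ->
  (forall i, Er P (V i) = 0) ->
  \sum_(i < n) Er P (fun x => V i x ^+ 2) <= 1 ->
  (P [set x | (m.+1%:R <= `|\sum_(i < n) V i x|)%R] <= (2 / m.+1`!%:R)%R%:E)%E.
Proof.
move=> iV V1 V0 Vs.
have bV i : bounded_rv (V i) by split; [exact: measurable_funP|exists 1].
pose V' i : {mfun T >-> R} := (- V i)%R.
have iV' : mutually_independent P n V'.
  move=> A mA; pose A' i : set R := -%R @^-1` A i.
  have mA' i : measurable (A' i).
    rewrite -[A' i]setTI; exact: (@oppr_measurable R setT).
  exact: (iV A' mA').
have V'1 i x : `|V' i x| <= 1 by rewrite /V'/= normrN.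
have V'E i : (V' i : T -> R) = (fun x => (-1) * V i x).
  by apply/funext => x; rewrite mulN1r.
have V'0 i : Er P (V' i) = 0 by rewrite V'E ErZ// V0 mulr0.
have V's : \sum_(i < n) Er P (fun x => V' i x ^+ 2) <= 1.
  by rewrite (eq_bigr (fun i : 'I_n => Er P (fun x => V i x ^+ 2)))// => i _;
    congr Er; apply/funext => x; rewrite /V'/= sqrrN.
have mS (W : nat -> {mfun T >-> R}) : measurable [set x | m.+1%:R <= \sum_(i < n) W i x].
  have mU : measurable_fun setT (fun x => \sum_(i < n) W i x).
    by apply: measurable_sum => i; exact: measurable_funP.
  rewrite (_ : [set x | _] = (fun x => \sum_(i < n) W i x) @^-1` `[m.+1%:R, +oo[).
    by rewrite -[_ @^-1` _]setTI; apply: mU.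
  by apply/seteqP; split=> x /=; rewrite in_itv/= andbT.
have -> : (2 / m.+1`!%:R)%R%:E = ((m.+1`!%:R^-1)%:E + (m.+1`!%:R^-1)%:E :> \bar R)%E.
  by rewrite -EFinD; congr EFin; rewrite mulrDl !mul1r.
apply: le_trans (leeD (upper_tail_le_invfact m iV V1 V0 Vs)
  (upper_tail_le_invfact m iV' V'1 V'0 V's)).
apply: le_trans (measureU2 _ (mS V) (mS V')).
rewrite [X in P X](_ : _ = [set x | m.+1%:R <= \sum_(i < n) V i x] `|`
   [set x | m.+1%:R <= \sum_(i < n) V' i x])//.
have sE x : \sum_(i < n) V' i x = - \sum_(i < n) V i x by rewrite -sumrN.
apply/seteqP; split=> x /=; rewrite sE ler_normr; first by move=> /orP.
by move=> [->|->]; rewrite ?orbT.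
Qed.

End bennett.

(** * Translation operators *)

Section translation_operators.
Context (R : realType).
Local Open Scope ereal_scope.
Implicit Types (p q : probability R R) (h g w : R -> \bar R).

Definition nnmeasurable h := measurable_fun setT h /\ forall x, 0 <= h x.

(** [h |-> int w(y) h(. + y) dp(y)], convolution with the reflection of the measure
    [w dp]. *)
Definition translate_avg p w h (x : R) := \int[p]_y (w y * h (x + y)%R).

Lemma nnmeasurableD h g : nnmeasurable h -> nnmeasurable g ->
  nnmeasurable (fun x => h x + g x).
Proof.
move=> [mh h0] [mg g0]; split; first exact: emeasurable_funD.
by move=> x; rewrite adde_ge0.
Qed.

Lemma nnmeasurableZ (c : R) h : (0 <= c)%R -> nnmeasurable h ->
  nnmeasurable (fun x => c%:E * h x).
Proof.
move=> c0 [mh h0]; split; first exact: emeasurable_funM.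
by move=> x; rewrite mule_ge0// lee_fin.
Qed.

Lemma nnmeasurable_shift h (x : R) : nnmeasurable h ->
  nnmeasurable (fun y => h (x + y)%R).
Proof.
move=> [mh h0]; split; last by move=> y; exact: h0.
by apply: measurableT_comp => //; exact: measurable_funD.
Qed.

Lemma nnmeasurableM h g : nnmeasurable h -> nnmeasurable g ->
  nnmeasurable (fun x => h x * g x).
Proof.
move=> [mh h0] [mg g0]; split; first exact: emeasurable_funM.
by move=> x; rewrite mule_ge0.
Qed.

Lemma nnmeasurable_translate_avg p w h : nnmeasurable w -> nnmeasurable h ->
  nnmeasurable (translate_avg p w h).
Proof.
move=> [mw w0] [mh h0]; split; last first.
  by move=> x; apply: integral_ge0 => y _; rewrite mule_ge0.
apply: (measurable_fun_fubini_tonelli_F (fun z : R * R => w z.2 * h (z.1 + z.2)%R)).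
  apply: emeasurable_funM; first exact: measurableT_comp.
  by apply: measurableT_comp => //; exact: measurable_funD.
by move=> z; rewrite mule_ge0.
Qed.

Lemma translate_avg_le p w h g x : nnmeasurable w -> nnmeasurable h ->
  nnmeasurable g -> (forall x, h x <= g x) ->
  translate_avg p w h x <= translate_avg p w g x.
Proof.
move=> nw nh ng hg; rewrite /translate_avg.
have [mh h0] := nnmeasurableM nw (nnmeasurable_shift x nh).
have [mg g0] := nnmeasurableM nw (nnmeasurable_shift x ng).
apply: ge0_le_integral => // y _; apply: lee_wpmul2l => //.
exact: nw.2.
Qed.

Lemma translate_avgD p w h g x : nnmeasurable w -> nnmeasurable h ->
  nnmeasurable g -> translate_avg p w (fun x => h x + g x) x =
  translate_avg p w h x + translate_avg p w g x.
Proof.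
move=> nw nh ng; rewrite /translate_avg.
have [mh h0] := nnmeasurableM nw (nnmeasurable_shift x nh).
have [mg g0] := nnmeasurableM nw (nnmeasurable_shift x ng).
rewrite -ge0_integralD//; apply: eq_integral => y _.
by rewrite ge0_muleDr//; [exact: nh.2|exact: ng.2].
Qed.

Lemma translate_avgZ p w h (c : R) x : (0 <= c)%R -> nnmeasurable w ->
  nnmeasurable h -> translate_avg p w (fun x => c%:E * h x) x =
  c%:E * translate_avg p w h x.
Proof.
move=> c0 nw nh; rewrite /translate_avg.
have [mh h0] := nnmeasurableM nw (nnmeasurable_shift x nh).
by rewrite -ge0_integralZl//; apply: eq_integral => y _; rewrite muleCA.
Qed.

(** Tonelli's theorem; the commutation of these operators is what makes their
    exponential series behave as in the scalar case. *)
Lemma translate_avgC p q w v h x : nnmeasurable w -> nnmeasurable v ->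
  nnmeasurable h -> translate_avg p w (translate_avg q v h) x =
  translate_avg q v (translate_avg p w h) x.
Proof.
move=> nw nv nh; rewrite /translate_avg.
pose f (z : R * R) := w z.1 * (v z.2 * h (x + z.1 + z.2)%R).
have f0 z : 0 <= f z by rewrite !mule_ge0//; [exact: nw.2|exact: nv.2|exact: nh.2].
have mf : measurable_fun setT f.
  apply: emeasurable_funM; first exact: measurableT_comp nw.1 _.
  apply: emeasurable_funM; first exact: measurableT_comp nv.1 _.
  apply: measurableT_comp nh.1 _; apply: measurable_funD => //.
  exact: measurable_funD.
transitivity (\int[p]_y \int[q]_z f (y, z)).
  apply: eq_integral => y _; rewrite -ge0_integralZl//.
  - exact: (nnmeasurableM nv (nnmeasurable_shift _ nh)).1.
  - by move=> z _; rewrite mule_ge0//; [exact: nv.2|exact: nh.2].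
  - exact: nw.2.
rewrite fubini_tonelli//; apply: eq_integral => z _ /=.
rewrite -ge0_integralZl//.
- by apply: eq_integral => y _; rewrite /f/= muleCA addrAC.
- exact: (nnmeasurableM nw (nnmeasurable_shift _ nh)).1.
- by move=> y _; rewrite mule_ge0//; [exact: nw.2|exact: nh.2].
- exact: nv.2.
Qed.

Section jump_operators.
Variables (p : nat -> probability R R) (w : R -> \bar R).
Hypothesis nw : nnmeasurable w.

Let V i := translate_avg (p i) w.

(** Translation average against the sum of the first [k] measures [w d(p i)]. *)
Definition jump_op (k : nat) h (x : R) := \sum_(i < k) V i h x.

Lemma nnmeasurable_jump_op k h : nnmeasurable h -> nnmeasurable (jump_op k h).
Proof.
move=> nh; rewrite /jump_op; elim: k => [|k ih].
  by under eq_fun do rewrite big_ord0; split => //; exact: measurable_cst.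
under eq_fun do rewrite big_ord_recr/=.
by apply: nnmeasurableD => //; exact: nnmeasurable_translate_avg.
Qed.

Lemma nnmeasurable_iter_jump_op m k h :
  nnmeasurable h -> nnmeasurable (iter m (jump_op k) h).
Proof. by move=> nh; elim: m => //= m ih; exact: nnmeasurable_jump_op. Qed.

Lemma jump_op_le k h g x : nnmeasurable h -> nnmeasurable g ->
  (forall x, h x <= g x) -> jump_op k h x <= jump_op k g x.
Proof. by move=> nh ng hg; apply: lee_sum => i _; exact: translate_avg_le. Qed.

Lemma jump_opD k h g x : nnmeasurable h -> nnmeasurable g ->
  jump_op k (fun x => h x + g x) x = jump_op k h x + jump_op k g x.
Proof.
move=> nh ng; rewrite /jump_op -big_split/=.
by apply: eq_bigr => i _; exact: translate_avgD.
Qed.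

Lemma jump_opZ k h (c : R) x : (0 <= c)%R -> nnmeasurable h ->
  jump_op k (fun x => c%:E * h x) x = c%:E * jump_op k h x.
Proof.
move=> c0 nh; rewrite /jump_op ge0_sume_distrr.
  by apply: eq_bigr => i _; exact: translate_avgZ.
by move=> i _; exact: (nnmeasurable_translate_avg (p i) nw nh).2.
Qed.

Lemma jump_opC k i h x : nnmeasurable h ->
  jump_op k (V i h) x = V i (jump_op k h) x.
Proof.
move=> nh; rewrite [LHS]/jump_op; elim: k => [|k ih].
  rewrite big_ord0 /V /translate_avg; apply/esym/integral0_eq => y _.
  by rewrite /jump_op big_ord0 mule0.
rewrite big_ord_recr/= ih [V k _ _]translate_avgC//.
rewrite (_ : jump_op k.+1 h = (fun x => jump_op k h x + V k h x)); last first.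
  by apply/funext => y; rewrite /jump_op big_ord_recr.
rewrite [RHS]translate_avgD//; last exact: nnmeasurable_translate_avg.
exact: (nnmeasurable_jump_op k nh).
Qed.

Lemma iter_jump_opD m k h g x : nnmeasurable h -> nnmeasurable g ->
  iter m (jump_op k) (fun x => h x + g x) x =
  iter m (jump_op k) h x + iter m (jump_op k) g x.
Proof.
move=> nh ng; elim: m x => [//|m ih] x /=.
rewrite -jump_opD; [|exact: nnmeasurable_iter_jump_op..].
by congr (jump_op k _ x); apply/funext => y; exact: ih.
Qed.

Lemma iter_jump_opC m k i h x : nnmeasurable h ->
  iter m (jump_op k) (V i h) x = V i (iter m (jump_op k) h) x.
Proof.
move=> nh; elim: m x => [//|m ih] x /=.
rewrite -jump_opC; last exact: nnmeasurable_iter_jump_op.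
by congr (jump_op k _ x); apply/funext => y; exact: ih.
Qed.

(** Two terms of the binomial expansion of [(A + V)^(m+1)], for commuting positive
    operators: [(A + V)^(m+1) >= A^(m+1) + (m + 1) V A^m]. *)
Lemma iter_jump_opS_ge m k h x : nnmeasurable h ->
  iter m.+1 (jump_op k) h x + m.+1%:R%:E * V k (iter m (jump_op k) h) x <=
  iter m.+1 (jump_op k.+1) h x.
Proof.
move=> nh; elim: m x => [|m ih] x.
  by rewrite /= mul1e [leRHS]/jump_op big_ord_recr.
have nW j l : nnmeasurable (iter j (jump_op l) h).
  exact: nnmeasurable_iter_jump_op.
have nV g : nnmeasurable g -> nnmeasurable (V k g).
  exact: nnmeasurable_translate_avg.
have nVW := nV _ (nW m k).
have nmVW := nnmeasurableZ (ler0n R m.+1) nVW.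
have nS := nnmeasurableD (nW m.+1 k) nmVW.
rewrite -[leRHS]/(jump_op k.+1 (iter m.+1 (jump_op k.+1) h) x).
apply: le_trans; last first.
  by apply: jump_op_le ih => //; exact: nW.
rewrite [leRHS]/jump_op big_ord_recr/=.
rewrite -[X in _ <= X + _]/(jump_op k (fun y => iter m.+1 (jump_op k) h y +
  m.+1%:R%:E * V k (iter m (jump_op k) h) y) x).
rewrite (jump_opD k x (nW m.+1 k) nmVW) (jump_opZ k x (ler0n _ _) nVW).
rewrite (jump_opC k k x (nW m k)).
rewrite -addeA leeD2l// -[in leLHS]natr1 EFinD ge0_muleDl ?lee_fin// mul1e leeD2l//.
apply: translate_avg_le; [exact: nw|exact: (nW m.+1 k)|exact: nS|].
by move=> y; rewrite leeDl//; exact: nmVW.2.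
Qed.

End jump_operators.

Lemma jump_op_avg_le (p : nat -> probability R R) w q n m h x :
  nnmeasurable w -> nnmeasurable h ->
  (forall g x, nnmeasurable g ->
    jump_op p w n g x <= translate_avg q (cst 1) g x) ->
  iter m (jump_op p w n) h x <= iter m (translate_avg q (cst 1)) h x.
Proof.
move=> nw nh le1; elim: m x => [//|m ih] x /=.
have n1 : nnmeasurable (cst 1 : R -> \bar R) by split.
have ni : nnmeasurable (iter m (translate_avg q (cst 1)) h).
  by elim: (m) => //= k; exact: nnmeasurable_translate_avg.
apply: le_trans; last exact: (le1 _ _ ni).
by apply: jump_op_le ni ih => //; exact: nnmeasurable_iter_jump_op.
Qed.

End translation_operators.

(** * Sums of independent variables through translation operators *)

Section sums_and_translations.
Context d (T : measurableType d) (R : realType) (P : probability T R).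
Local Open Scope ereal_scope.
Implicit Types (Z : nat -> {mfun T >-> R}) (h : R -> \bar R).

Lemma integral_probability_cst (r : \bar R) : \int[P]_a r = r.
Proof. by rewrite integral_cst// [X in _ * X]probability_setT mule1. Qed.

Lemma integral_independent_shift (U V : {mfun T >-> R}) h (x : R) :
  independent2 P U V -> nnmeasurable h ->
  \int[P]_a h (x + (U a + V a))%R =
  \int[P]_a translate_avg (distribution P V) (cst 1) h (x + U a)%R.
Proof.
move=> UV nh; have n1 : nnmeasurable (cst 1 : R -> \bar R) by split.
pose f (z : R * R) := h (x + (z.1 + z.2))%R.
have mf : measurable_fun setT f.
  apply: measurableT_comp nh.1 _; apply: measurable_funD => //.
  exact: measurable_funD.
have f0 z : 0 <= f z by exact: nh.2.
rewrite [LHS](integral_independent2 UV mf f0) fubini_tonelli1//.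
rewrite ge0_integral_distribution//.
- apply: eq_integral => a _; rewrite /fubini_F/= /translate_avg.
  by apply: eq_integral => y _; rewrite mul1e /f/= addrA.
- exact: measurable_fun_fubini_tonelli_F.
- by move=> y; apply: integral_ge0 => z _; exact: f0.
Qed.

(** Conditioning on the last variable of the sum turns it into a translation
    average, so that [m] independent copies give the [m]-th power. *)
Lemma expectation_iid_sum Z n (q : probability R R) k h (x : R) :
  mutually_independent P n Z ->
  (forall i g, (i < n)%N -> nnmeasurable g -> \int[P]_a g (Z i a) = \int[q]_y g y) ->
  nnmeasurable h -> (k <= n)%N ->
  \int[P]_a h (x + \sum_(i < k) Z i a)%R =
  iter k (translate_avg q (cst 1)) h x.
Proof.
move=> iZ Zq; have n1 : nnmeasurable (cst 1 : R -> \bar R) by split.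
elim: k h => [|k ih] h nh kn.
  under eq_integral do rewrite big_ord0 addr0.
  by rewrite integral_probability_cst.
pose U : {mfun T >-> R} := (\sum_(i < k) Z i)%R.
have UE a : U a = (\sum_(i < k) Z i a)%R by rewrite /U mfun_sum.
under eq_integral do rewrite big_ord_recr/= -UE.
have UZ : independent2 P U (Z k).
  rewrite (_ : (U : T -> R) = (fun a => \sum_(i < k) Z i a)%R); last exact/funext.
  exact: independent_partial_sum iZ.
rewrite (integral_independent_shift _ UZ nh).
have -> : translate_avg (distribution P (Z k)) (cst 1) h = translate_avg q (cst 1) h.
  apply/funext => y; rewrite /translate_avg.
  rewrite ge0_integral_distribution.
  - rewrite -(Zq k)//.
    exact: nnmeasurableM n1 (nnmeasurable_shift _ nh).
  - exact: (nnmeasurableM n1 (nnmeasurable_shift _ nh)).1.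
  - exact: (nnmeasurableM n1 (nnmeasurable_shift _ nh)).2.
under eq_integral do rewrite UE.
rewrite ih ?(ltnW kn)//; last exact: nnmeasurable_translate_avg.
by rewrite -iterSr.
Qed.

(** This is [prod_(i < k) (1 + V_i) <= exp (sum_(i < k) V_i)] for the translation
    averages [V_i] over the nonzero values of [Z i]. Only powers up to [k] occur,
    which keeps the sum finite. *)
Lemma expectation_sum_le_jumps Z n (w : R -> \bar R) k h (x : R) :
  mutually_independent P n Z -> nnmeasurable w ->
  (forall i a, Z i a = 0%R \/ w (Z i a) = 1) ->
  nnmeasurable h -> (k <= n)%N ->
  \int[P]_a h (x + \sum_(i < k) Z i a)%R <=
  \sum_(m < k.+1) (m`!%:R^-1)%:E *
    iter m (jump_op (fun i => distribution P (Z i)) w k) h x.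
Proof.
move=> iZ nw Zw; have n1 : nnmeasurable (cst 1 : R -> \bar R) by split.
set p := (X in jump_op X).
have jge0 m l g y : nnmeasurable g -> 0 <= iter m (jump_op p w l) g y.
  by move=> ng; exact: (nnmeasurable_iter_jump_op p nw m l ng).2.
have inv0 m : (0 <= m`!%:R^-1 :> R)%R by rewrite invr_ge0.
elim: k h => [|k ih] h nh kn.
  under eq_integral do rewrite big_ord0 addr0.
  rewrite integral_probability_cst big_ord_recl big_ord0 adde0.
  by rewrite fact0 invr1 mul1e.
pose U : {mfun T >-> R} := (\sum_(i < k) Z i)%R.
have UE a : U a = (\sum_(i < k) Z i a)%R by rewrite /U mfun_sum.
under eq_integral do rewrite big_ord_recr/= -UE.
have UZ : independent2 P U (Z k).
  rewrite (_ : (U : T -> R) = (fun a => \sum_(i < k) Z i a)%R); last exact/funext.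
  exact: independent_partial_sum iZ.
rewrite (integral_independent_shift _ UZ nh).
have nV := nnmeasurable_translate_avg (p k) nw nh.
have nhV := nnmeasurableD nh nV.
have nh1 := nnmeasurable_translate_avg (p k) n1 nh.
(* a zero value of [Z k] contributes at most [h y], a nonzero one has weight 1 *)
have avg_le y : translate_avg (p k) (cst 1) h y <= h y + translate_avg (p k) w h y.
  rewrite /translate_avg /p.
  have nw1 := nnmeasurableM n1 (nnmeasurable_shift y nh).
  have nw2 := nnmeasurableM nw (nnmeasurable_shift y nh).
  rewrite ge0_integral_distribution; [|exact: nw1.1|exact: nw1.2].
  rewrite ge0_integral_distribution; [|exact: nw2.1|exact: nw2.2].
  rewrite -[X in X + _]integral_probability_cst.
  rewrite -ge0_integralD//.
  - apply: ge0_le_integral => //.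
    + by move=> a _; exact: nw1.2.
    + exact: measurableT_comp nw1.1 _.
    + by apply: emeasurable_funD => //; exact: measurableT_comp nw2.1 _.
    + move=> a _ /=; rewrite mul1e.
      have [->|->] := Zw k a; last by rewrite mul1e leeDr//; exact: nh.2.
      by rewrite addr0 leeDl// mule_ge0//; [exact: nw.2|exact: nh.2].
  - by move=> a _; exact: nh.2.
  - by move=> a _; exact: nw2.2.
  - exact: measurableT_comp nw2.1 _.
apply: (@le_trans _ _ (\int[P]_a (fun y => h y + translate_avg (p k) w h y) (x + U a)%R)).
  apply: ge0_le_integral => //.
  - by move=> a _; exact: nh1.2.
  - by apply: measurableT_comp nh1.1 _; exact: measurable_funD.
  - by apply: measurableT_comp nhV.1 _; exact: measurable_funD.
  - by move=> a _; exact: avg_le.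
under eq_integral do rewrite UE.
apply: le_trans (ih _ nhV (ltnW kn)) _.
under eq_bigr => m _ do rewrite (iter_jump_opD p nw m k x nh nV)
  (iter_jump_opC p nw m k k x nh).
pose b m := (m`!%:R^-1)%:E * iter m (jump_op p w k) h x.
pose e m := (m`!%:R^-1)%:E * translate_avg (p k) w (iter m (jump_op p w k) h) x.
have nW m l := nnmeasurable_iter_jump_op p nw m l nh.
have b0 m : 0 <= b m by rewrite /b mule_ge0 ?lee_fin//; exact: jge0.
have e0 m : 0 <= e m.
  rewrite /e mule_ge0 ?lee_fin//.
  exact: (nnmeasurable_translate_avg (p k) nw (nW m k)).2.
rewrite (eq_bigr (fun m : 'I_k.+1 => b m + e m)); last first.
  move=> m _; rewrite ge0_muleDr//; first exact: jge0.
  exact: (nnmeasurable_translate_avg (p k) nw (nW m k)).2.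
rewrite big_split/= [leRHS]big_ord_recl.
have -> : (\sum_(m < k.+1) b m + \sum_(m < k.+1) e m =
    b 0%N + (\sum_(m < k) b m.+1 + \sum_(m < k.+1) e m))%R.
  by rewrite [X in (X + _)%R = _]big_ord_recl addrA.
apply: leeD; first by [].
apply: (@le_trans _ _ (\sum_(m < k.+1) (b m.+1 + e m))).
  rewrite big_split/= [X in _ <= X + _]big_ord_recr/=.
  by apply: leeD => //; rewrite leeDl.
apply: lee_sum => m _; rewrite lift0 /b /e {b b0 e e0}.
apply: le_trans (lee_wpmul2l _ (iter_jump_opS_ge p nw m k x nh)); last by rewrite lee_fin.
rewrite [leRHS]ge0_muleDr; [|exact: (jge0 m.+1 k h x nh)|]; last first.
  rewrite mule_ge0 ?lee_fin//.
  exact: (nnmeasurable_translate_avg (p k) nw (nW m k)).2.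
by rewrite muleA -EFinM factS natrM invfM mulrAC mulVf// mul1r.
Qed.

End sums_and_translations.

(** * Domination by a compound Poisson law *)

Section poisson_domination.
Context (R : realType).
Local Open Scope ereal_scope.

Lemma integral_indic_mull (m : {measure set R -> \bar R}) (D : set R)
    (f : R -> \bar R) :
  measurable D -> \int[m]_y ((\1_D y)%:E * f y) = \int[m]_(y in D) f y.
Proof.
move=> mD; rewrite [RHS]integral_mkcond; apply: eq_integral => y _.
rewrite patchE indicE; case: ifPn => yD; last by rewrite mul0e.
by rewrite mul1e.
Qed.

Lemma nnmeasurable_indic (D : set R) :
  measurable D -> nnmeasurable (fun y => (\1_D y)%:E).
Proof.
move=> mD; split; last by move=> x; rewrite lee_fin.
by apply/measurable_EFinP; exact: measurable_indic.
Qed.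

(** Above [a] the laws [p i] add up to [q]: both sides are finite measures that
    agree on the half-lines [`]s, +oo[]. *)
Lemma jump_op_le_translate_avg (p : nat -> probability R R) n
    (q : probability R R) (a : R) g x :
  (forall s, (a <= s)%R -> \sum_(i < n) p i `]s, +oo[%classic = q `]s, +oo[%classic) ->
  nnmeasurable g ->
  jump_op p (fun y => (\1_(`]a, +oo[%classic) y)%:E) n g x <=
  translate_avg q (cst 1) g x.
Proof.
move=> pq ng; set D := `]a, +oo[%classic : set R.
have mD : measurable D by exact: measurable_itv.
have [mg g0] := nnmeasurable_shift x ng.
rewrite /jump_op /translate_avg.
under eq_bigr do rewrite integral_indic_mull//.
under [leRHS]eq_integral do rewrite mul1e.
have -> : \sum_(i < n) \int[p i]_(y in D) g (x + y)%R =
    \int[msum p n]_(y in D) g (x + y)%R.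
  by rewrite ge0_integral_measure_sum//; exact: measurable_funTS.
have eqD : forall A, measurable A -> mrestr (msum p n) mD A = mrestr q mD A.
  move=> A mA.
  apply: (measure_unique (@RGenOInfty.G R) (fun k => `]- k%:R, +oo[%classic)%R) => //.
  - exact: RGenOInfty.measurableE.
  - move=> _ _ [s ->] [t ->]; exists (Num.max s t).
    apply/seteqP; split=> [y/=|y/=]; rewrite !in_itv/= !andbT gt_max.
      by move=> [-> ->].
    by move=> /andP[].
  - by move=> i; eexists.
  - apply/seteqP; split=> // y _; exists (Num.bound `|y|) => //=.
    rewrite in_itv/= andbT ltrNl (le_lt_trans _ (archi_boundP (normr_ge0 y)))//.
    by rewrite -normrN ler_norm.
  - move=> _ [s ->]; rewrite /= /mrestr/=.
    rewrite [_ `&` _](_ : _ = `]Num.max s a, +oo[%classic); last first.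
      apply/seteqP; rewrite /D; split=> [y/=|y/=]; rewrite !in_itv/= !andbT gt_max.
        by move=> [-> ->].
      by move=> /andP[].
    by apply: pq; rewrite le_max lexx orbT.
  - move=> k; rewrite /= /mrestr/=.
    rewrite [_ `&` _](_ : _ = `]Num.max (- k%:R)%R a, +oo[%classic); last first.
      apply/seteqP; rewrite /D; split=> [y/=|y/=]; rewrite !in_itv/= !andbT gt_max.
        by move=> [-> ->].
      by move=> /andP[].
    rewrite [msum _ _ _]pq ?le_max ?lexx ?orbT//.
    by rewrite (le_lt_trans (probability_le1 _ _))// ltry.
rewrite [leLHS](eq_measure_integral q); last first.
  move=> A mA AD; have := eqD A mA; rewrite /mrestr.
  by rewrite (setIidl AD).
apply: ge0_subset_integral => //.
Qed.

(** The right-hand side is, up to the factor [e], the tail at [s] of a sum of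
    a Poisson(1) number of independent variables of law [q]. *)
Lemma poisson_domination d d' (T : measurableType d) (T' : measurableType d')
    (P : probability T R) (P' : probability T' R)
    (Z : nat -> {mfun T >-> R}) (W : nat -> {mfun T' >-> R}) (n : nat)
    (q : probability R R) (a s : R) :
  mutually_independent P n Z -> mutually_independent P' n W ->
  (forall i x, Z i x = 0 \/ a < Z i x)%R ->
  (forall r, (a <= r)%R ->
    \sum_(i < n) P (Z i @^-1` `]r, +oo[) = q `]r, +oo[%classic) ->
  (forall i g, (i < n)%N -> nnmeasurable g ->
    \int[P']_x g (W i x) = \int[q]_y g y) ->
  P [set x | (s < \sum_(i < n) Z i x)%R] <=
  \sum_(m < n.+1) (m`!%:R^-1)%:E * P' [set x | (s < \sum_(i < m) W i x)%R].
Proof.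
move=> iZ iW Za Zq Wq.
pose h (y : R) : \bar R := (\1_(`]s, +oo[%classic) y)%:E.
have nh : nnmeasurable h by exact: nnmeasurable_indic.
have Ph e (U : measurableType e) (Q : probability U R) (V : U -> R) :
    measurable_fun setT V ->
    Q [set x | (s < V x)%R] = \int[Q]_x h (0 + V x)%R.
  move=> mV; under eq_integral do rewrite add0r.
  transitivity (\int[Q]_x (\1_(V @^-1` `]s, +oo[) x)%:E); last by [].
  rewrite integral_indic//= ?setIT.
    by congr (Q _); apply/seteqP; split=> x /=; rewrite in_itv/= andbT.
  by rewrite -[_ @^-1` _]setTI; exact: mV.
have msumf e (U : measurableType e) (V : nat -> {mfun U >-> R}) k :
    measurable_fun setT (fun x => \sum_(i < k) V i x)%R.
  by apply: measurable_sum => i; exact: measurable_funP.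
rewrite (Ph _ _ P)//.
pose w (y : R) : \bar R := (\1_(`]a, +oo[%classic) y)%:E.
have nw : nnmeasurable w by exact: nnmeasurable_indic.
apply: (le_trans (expectation_sum_le_jumps 0%R iZ nw _ nh (leqnn n))).
  move=> i x; have [->|aZ] := Za i x; first by left.
  by right; rewrite /w indicE mem_set//= in_itv/= andbT.
apply: lee_sum => m _; apply: lee_wpmul2l; first by rewrite lee_fin invr_ge0.
rewrite (Ph _ _ P')// (expectation_iid_sum _ iW Wq nh); last by rewrite -ltnS.
apply: jump_op_avg_le => // g x ng.
by apply: jump_op_le_translate_avg => // r ar; exact: Zq.
Qed.

End poisson_domination.

(** * Tails and rearrangements *)

Section tails_and_rearrangements.
Context d (T : measurableType d) (R : realType).
Context (mu : {measure set T -> \bar R}) (D : set T).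
Implicit Types f : T -> R.

Definition tail f (s : R) : \bar R := mu (D `&` [set x | s < `|f x|]).

Definition measurable_tails f :=
  forall s, 0 <= s -> measurable (D `&` [set x | s < `|f x|]).

Definition vanishing_tails f :=
  forall t, 0 < t -> exists2 s, 0 <= s & (tail f s <= t%:E)%E.

Lemma measurable_fun_tails f : measurable D -> measurable_fun D f ->
  measurable_tails f.
Proof.
move=> mD mf s s0.
have mn : measurable_fun D (fun x => `|f x|) by exact: measurableT_comp.
have := mn mD _ (@measurable_itv R `]s, +oo[).
by congr measurable; apply/seteqP; split=> x /=; rewrite in_itv/= andbT.
Qed.

Lemma tail_anti f s t : measurable_tails f -> 0 <= s -> s <= t ->
  (tail f t <= tail f s)%E.
Proof.
move=> mf s0 st; apply: le_measure; rewrite ?inE; [|exact: mf|].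
  by apply: mf; exact: le_trans st.
by move=> x [Dx /= tx]; split => //=; exact: le_lt_trans tx.
Qed.

Lemma rearr_ge0 f t : 0 <= rearr mu D f t.
Proof.
rewrite /rearr; set S := [set s | _].
have [->|/set0P S0] := eqVneq S set0; first by rewrite inf0.
by apply: lb_le_inf => // x [].
Qed.

Lemma rearr_le f s t : 0 <= s -> (tail f s <= t%:E)%E -> rearr mu D f t <= s.
Proof.
move=> s0 st; apply: ge_inf => //.
by exists 0 => x [].
Qed.

(** The infimum that defines the rearrangement is attained, because the tail is
    right-continuous. *)
Lemma tail_rearr_le f t : measurable_tails f ->
  (exists2 s, 0 <= s & (tail f s <= t%:E)%E) ->
  (tail f (rearr mu D f t) <= t%:E)%E.
Proof.
move=> mf [s0 s00 s0t]; set r := rearr mu D f t.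
have r0 : 0 <= r by exact: rearr_ge0.
pose F n := D `&` [set x | r + n.+1%:R^-1 < `|f x|].
have FE : \bigcup_n F n = D `&` [set x | r < `|f x|].
  apply/seteqP; split=> [x [n _ [Dx /= h]]|x [Dx /= h]].
    by split => //=; rewrite (le_lt_trans _ h)// lerDl invr_ge0.
  have /ltr_add_invr[n nx] := h.
  by exists n.
have Ft n : (mu (F n) <= t%:E)%E.
  have [||s [s1 st] sr] := @inf_lt R [set s : R | 0 <= s /\ (tail f s <= t%:E)%E] (r + n.+1%:R^-1).
  - by exists s0.
  - by rewrite ltrDl invr_gt0.
  apply: le_trans st.
  by apply: tail_anti => //; exact: ltW.
have mF n : measurable (F n) by apply: mf; rewrite addr_ge0// invr_ge0.
have cF : mu (F n) @[n --> \oo] --> mu (\bigcup_n F n).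
  apply: nondecreasing_cvg_mu => //; first exact: bigcup_measurable.
  move=> m n mn; apply/subsetPset => x [Dx /= h]; split=> //=.
  by rewrite (le_lt_trans _ h)// lerD2l lef_pV2 ?posrE// ler_nat.
rewrite /tail -FE -(cvg_lim _ cF)//; apply: lime_le.
  by apply/cvg_ex; eexists; exact: cF.
by apply: nearW => n; exact: Ft.
Qed.

Lemma lt_rearr f s t : measurable_tails f -> 0 <= s ->
  (exists2 s, 0 <= s & (tail f s <= t%:E)%E) ->
  (s < rearr mu D f t) = (t%:E < tail f s)%E.
Proof.
move=> mf s0 ex; apply/idP/idP => h; rewrite ltNge; apply/negP => h'.
  by move: h; rewrite ltNge => /negP; apply; exact: rearr_le.
move: h; rewrite ltNge => /negP; apply.
rewrite (le_trans _ (tail_rearr_le mf ex))//.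
by apply: tail_anti => //; exact: rearr_ge0.
Qed.

(** Continuity from above of a finite measure. *)
Lemma finite_vanishing_tails f : measurable D -> (mu D < +oo)%E ->
  measurable_tails f -> vanishing_tails f.
Proof.
move=> mD muD mf t t0.
pose F n := D `&` [set x | n%:R < `|f x|].
have mF n : measurable (F n) by exact: mf.
have F0 : \bigcap_n F n = set0.
  apply/seteqP; split => // x Fx.
  have [_ /=] := Fx (Num.bound `|f x|) I.
  by rewrite ltNge ltW// archi_boundP.
have cF : mu (F n) @[n --> \oo] --> mu (\bigcap_n F n).
  apply: nonincreasing_cvg_mu => //.
  - rewrite (le_lt_trans _ muD)// le_measure ?inE//.
    by move=> x [].
  - by rewrite F0.
  - move=> m n mn; apply/subsetPset => x [Dx /= h]; split=> //=.
    by rewrite (le_lt_trans _ h)// ler_nat.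
rewrite F0 measure0 in cF.
have : \forall n \near \oo, (mu (F n) < t%:E)%E.
  by apply: (cF [set y | (y < t%:E)%E]); apply: open_ereal_lt'; rewrite lte_fin.
by case=> N _ /(_ N (leqnn N)) /ltW h; exists N%:R.
Qed.

End tails_and_rearrangements.

(** * Lebesgue measure on the unit interval *)

Section unit_interval.
Context (R : realType).
Local Notation lam := (@lebesgue_measure R).
Implicit Types f g : R -> R.

Lemma measurable_unit_itv : measurable (unit_itv R).
Proof. exact: measurable_itv. Qed.

Lemma lebesgue_unit_itv : lam (unit_itv R) = 1%E.
Proof. by rewrite /unit_itv lebesgue_measure_itv/= lte_fin ltr01 oppr0 adde0. Qed.

Definition unif01 : set (measurableTypeR R) -> \bar R := mrestr lam measurable_unit_itv.

Let unif01_0 : unif01 set0 = 0%E.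
Proof. exact: measure0. Qed.

Let unif01_ge0 A : (0 <= unif01 A)%E.
Proof. exact: measure_ge0. Qed.

Let unif01_sigma_additive : semi_sigma_additive unif01.
Proof. exact: (@measure_semi_sigma_additive _ _ _ (mrestr lam measurable_unit_itv)). Qed.

HB.instance Definition _ := isMeasure.Build _ _ _ unif01
  unif01_0 unif01_ge0 unif01_sigma_additive.

Let unif01_setT : unif01 setT = 1%E.
Proof. by rewrite /unif01/= /mrestr setTI lebesgue_unit_itv. Qed.

HB.instance Definition _ := Measure_isProbability.Build _ _ _ unif01 unif01_setT.

Lemma unif01E (A : set R) : unif01 A = lam (unit_itv R `&` A).
Proof. by rewrite /unif01/= /mrestr setIC. Qed.

Lemma ge0_integral_unif01 (f : R -> \bar R) :
  measurable_fun setT f -> (forall x, 0 <= f x)%E ->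
  (\int[unif01]_x f x = \int[lam]_(x in unit_itv R) f x)%E.
Proof.
move=> mf f0.
have mI := measurable_unit_itv.
rewrite -(setUv (unit_itv R)) ge0_integral_setU//.
- rewrite [X in (_ + X)%E](_ : _ = 0%E) ?adde0; last first.
    apply: null_set_integral => //; first exact: measurableC.
      exact: measurable_funTS.
    by apply: etrans (unif01E _) _; rewrite setICr measure0.
  apply: eq_measure_integral => A mA AI.
  by apply: etrans (unif01E _) _; rewrite (setIidr AI).
- exact: measurableC.
- by rewrite setUv.
- exact/disj_setPCl.
Qed.

(** Covers both the translations of the disjointification ([a = 1]) and the
    dilations by 2 used to cut a function into two halves. *)
Lemma lebesgue_preimage_affine (a b : R) (A : set R) : 0 < a ->
  measurable A -> lam ((fun t => a * t + b) @^-1` A) = ((a^-1)%:E * lam A)%E.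
Proof.
move=> a0 mA.
pose h : measurableTypeR R -> measurableTypeR R := fun t => a * t + b.
have mh : measurable_fun setT h.
  by apply: measurable_funD => //; exact: mulrl_measurable.
pose mu : {measure set (measurableTypeR R) -> \bar R} :=
  mscale (NngNum (ltW a0)) (pushforward lam h).
have muE : forall X, ocitv X -> lam X = mu mh X.
  move=> _ [[x y]] _ <-.
  have hE : h @^-1` `]x, y]%classic = `](x - b) / a, (y - b) / a]%classic.
    apply/seteqP; split=> t /=; rewrite !in_itv/= ltr_pdivrMr// ler_pdivlMr//;
      by rewrite /h ltrBlDr lerBrDr (mulrC t).
  rewrite -[RHS]/(a%:E * lam (h @^-1` `]x, y]%classic))%E hE.
  rewrite !lebesgue_measure_itv/= !lte_fin ltr_pM2r ?invr_gt0// ltrD2r.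
  case: ifP => xy; last by rewrite mule0.
  by rewrite -!EFinB -EFinM; congr EFin; field; rewrite gt_eqF.
rewrite (lebesgue_measure_unique muE mA) /mu /= /mscale/= muleA -EFinM mulVf ?gt_eqF// mul1e.
by [].
Qed.

(** Endpoints and integers, where the descriptions of a set by intervals fail,
    are absorbed by the finite set [N]. *)
Lemma lebesgue_between_finite (A I N : set R) : finite_set N ->
  measurable I -> I `<=` A -> A `<=` I `|` N ->
  measurable A /\ lam A = lam I.
Proof.
move=> fN mI IA AI.
have cA : countable (A `&` N).
  by apply: finite_set_countable; apply: (@sub_finite_set _ _ N).
have AE : A = I `|` (A `&` N).
  apply/seteqP; split=> [x Ax|x [/IA//|[]//]].
  by have [Ix|xN] := AI _ Ax; [left|right].
have mA : measurable A.
  by rewrite AE; apply: measurableU => //; exact: countable_measurable.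
split=> //; apply/eqP; rewrite eq_le; apply/andP; split; last first.
  by apply: le_measure; rewrite ?inE.
rewrite [in leLHS]AE (le_trans (measureU2 _ _ _))//.
  exact: countable_measurable.
by rewrite [X in (_ + X)%E]countable_lebesgue_measure0// adde0.
Qed.

Lemma lebesgue_between (A I : set R) : measurable I -> I `<=` A ->
  A `<=` I `|` [set 0; 1] -> measurable A /\ lam A = lam I.
Proof. exact: lebesgue_between_finite. Qed.

End unit_interval.

Section rearrangement_tail.
Context d (T : measurableType d) (R : realType).
Context (mu : {measure set T -> \bar R}) (D : set T) (f : T -> R).
Hypotheses (mf : measurable_tails D f) (vf : vanishing_tails mu D f).
Local Notation lam := (@lebesgue_measure R).

Let superlevel (s : R) : set R :=
  unit_itv R `&` [set t | s < `|rearr mu D f t|].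

Let superlevelP s : 0 <= s -> measurable (superlevel s) /\
  lam (superlevel s) = Order.min (tail mu D f s) 1%E.
Proof.
move=> s0; set m := Order.min _ _.
have m0 : (0 <= m)%E by rewrite le_min measure_ge0 lee01.
have m1 : (m <= 1)%E by rewrite ge_min lexx orbT.
have mfin : m \is a fin_num.
  by rewrite ge0_fin_numE// (le_lt_trans m1)// ltry.
have lamI : lam `]0, fine m[%classic = m.
  rewrite lebesgue_measure_itv/= lte_fin oppr0 adde0 fineK//.
  case: ifPn => // /negP h; apply/eqP; rewrite eq_le m0/=.
  by rewrite -(fineK mfin) lee_fin leNgt; apply/negP.
have supE t : 0 < t -> (s < `|rearr mu D f t|) = (t%:E < tail mu D f s)%E.
  by move=> t0; rewrite ger0_norm ?rearr_ge0// lt_rearr//; exact: vf.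
rewrite -lamI; apply: lebesgue_between.
- exact: measurable_itv.
- move=> t /=; rewrite in_itv/= => /andP[t0 tm].
  have {}tm : (t%:E < m)%E by rewrite -(fineK mfin) lte_fin.
  split.
    rewrite /unit_itv /= in_itv/= ltW//= -lee_fin.
    exact: le_trans (ltW tm) m1.
  by rewrite /= supE// (lt_le_trans tm)// ge_min lexx.
- move=> t [] /=; rewrite /unit_itv/= in_itv/= => /andP[t0 t1] st.
  have [->|tn0] := eqVneq t 0; first by right; left.
  have [->|tn1] := eqVneq t 1; first by right; right.
  left; have {}t0 : 0 < t by rewrite lt_neqAle eq_sym tn0.
  rewrite in_itv/= t0/= -lte_fin fineK// /m lt_min -supE// st/=.
  by rewrite lte_fin lt_neqAle tn1.
Qed.

(** For [t > 0], [s < f^*(t)] means [t < tail f s]: the superlevel set in [[0,1]]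
    is an initial interval, up to its end points. *)
Lemma tail_rearr s : 0 <= s ->
  tail lam (unit_itv R) (rearr mu D f) s = Order.min (tail mu D f s) 1%E.
Proof. by move=> /superlevelP[]. Qed.

Lemma measurable_rearr : measurable_fun (unit_itv R) (rearr mu D f).
Proof.
apply: (measurability (@RGenOInfty.G R)) => [|/= _ [_] [s] -> <-].
  exact: RGenOInfty.measurableE.
have [s0|s0] := leP 0 s.
  have [ms _] := superlevelP s0; move: ms; congr measurable.
  apply/seteqP; split=> t /=; rewrite /superlevel/= in_itv/= andbT.
    by move=> [tI]; rewrite ger0_norm ?rearr_ge0.
  by move=> [tI h]; rewrite ger0_norm ?rearr_ge0.
rewrite setIidl; first exact: measurable_unit_itv.
by move=> t _ /=; rewrite in_itv/= andbT (lt_le_trans s0)// rearr_ge0.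
Qed.

End rearrangement_tail.

(** * Tails on the unit interval *)

Section tail01.
Context (R : realType).
Local Notation lam := (@lebesgue_measure R).
Local Notation I01 := (unit_itv R).
Implicit Types f g : R -> R.

Definition tail01 f s := tail lam I01 f s.

Lemma measurable_tails01 f : measurable_fun I01 f -> measurable_tails I01 f.
Proof. by move=> mf; apply: measurable_fun_tails => //; exact: measurable_unit_itv. Qed.

Lemma vanishing_tails01 f : measurable_fun I01 f -> vanishing_tails lam I01 f.
Proof.
move=> mf; apply: finite_vanishing_tails.
- exact: measurable_unit_itv.
- by rewrite [X in (X < _)%E]lebesgue_unit_itv ltry.
- exact: measurable_tails01.
Qed.

Lemma tail01_le1 f s : measurable_fun I01 f -> 0 <= s -> (tail01 f s <= 1)%E.
Proof.
move=> mf s0; rewrite -(lebesgue_unit_itv R) /tail01 /tail le_measure ?inE//.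
- exact: measurable_tails01.
- exact: measurable_unit_itv.
Qed.

Lemma tail01_eq f g s : {in I01, forall x, `|f x| = `|g x|} ->
  tail01 f s = tail01 g s.
Proof.
move=> fg; rewrite /tail01 /tail; congr lam.
by apply/seteqP; split=> x [Ix /= h]; split=> //=; move: h; rewrite fg// inE.
Qed.

Lemma tail01_le f g s : measurable_fun I01 f -> measurable_fun I01 g ->
  0 <= s -> {in I01, forall x, `|f x| <= `|g x|} ->
  (tail01 f s <= tail01 g s)%E.
Proof.
move=> mf mg s0 fg; apply: le_measure; rewrite ?inE.
- exact: measurable_tails01.
- exact: measurable_tails01.
- by move=> x [Ix /= h]; split=> //=; rewrite (lt_le_trans h)// fg// inE.
Qed.

Lemma tail01_rearr01 f s : measurable_fun I01 f -> 0 <= s ->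
  tail01 (rearr01 f) s = tail01 f s.
Proof.
move=> mf s0; rewrite /tail01 /rearr01 tail_rearr//.
- by apply/min_idPl; exact: tail01_le1.
- exact: measurable_tails01.
- exact: vanishing_tails01.
Qed.

Definition restrict01 f : R -> R := f \_ I01.

Lemma measurable_restrict01 f :
  measurable_fun I01 f -> measurable_fun setT (restrict01 f).
Proof. by move=> mf; apply/(measurable_restrictT _ (@measurable_unit_itv R)). Qed.

Lemma restrict01E f x : I01 x -> restrict01 f x = f x.
Proof. by move=> Ix; rewrite /restrict01 patchE mem_set. Qed.

(** Halves the tail of each argument; the inverse operation is to cut a function
    of [[0,1]] at 1/2. *)
Definition splice g1 g2 (t : R) := if t < 2^-1 then g1 (2 * t) else g2 (2 * t - 1).

Lemma measurable_splice g1 g2 : measurable_fun setT g1 -> measurable_fun setT g2 ->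
  measurable_fun setT (splice g1 g2).
Proof.
move=> m1 m2; apply: measurable_fun_ifT.
- exact: measurable_fun_ltr.
- by apply: measurableT_comp => //; exact: mulrl_measurable.
- apply: measurableT_comp => //; apply: measurable_funB => //.
Qed.

Lemma tail01_splice g1 g2 s : measurable_fun setT g1 -> measurable_fun setT g2 ->
  0 <= s -> tail01 (splice g1 g2) s = ((2^-1)%:E * (tail01 g1 s + tail01 g2 s))%E.
Proof.
move=> m1 m2 s0.
have mt g : measurable_fun setT g -> measurable (I01 `&` [set x | s < `|g x|]).
  by move=> mg; apply: measurable_tails01 => //; exact: measurable_funTS.
pose A1 : set R := `[0, 1[ `&` [set x | s < `|g1 x|].
pose A2 : set R := I01 `&` [set x | s < `|g2 x|].
have mA1 : measurable A1.
  rewrite (_ : A1 = `[0, 1[ `&` (I01 `&` [set x | s < `|g1 x|])).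
    by apply: measurableI => //; exact: mt.
  rewrite /A1 setIA; congr (_ `&` _); apply/seteqP; split=> [x /= |x []//].
  rewrite /unit_itv/= !in_itv/= => /andP[x0 x1].
  by rewrite x0 x1 (ltW x1).
have [_ A1E] : measurable (I01 `&` [set x | s < `|g1 x|]) /\
    lam (I01 `&` [set x | s < `|g1 x|]) = lam A1.
  apply: lebesgue_between => //.
    move=> x [/=]; rewrite in_itv/= => /andP[x0 x1] h; split=> //.
    by rewrite /unit_itv/= in_itv/= x0 ltW.
  move=> x [/=]; rewrite /unit_itv/= in_itv/= => /andP[x0 x1] h.
  have [->|xn1] := eqVneq x 1; first by right; right.
  by left; split=> //=; rewrite in_itv/= x0 lt_neqAle xn1.
have two : 0 < 2 :> R by [].
have mpre (b : R) (A : set R) : measurable A ->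
    measurable ((fun t : R => 2 * t + b) @^-1` A).
  move=> mA; rewrite -[_ @^-1` _]setTI.
  have mh : measurable_fun setT (fun t : R => 2 * t + b).
    by apply: measurable_funD => //; exact: mulrl_measurable.
  exact: mh.
have {}A1E : tail01 g1 s = lam A1 by [].
have A2E : tail01 g2 s = lam A2 by [].
have sE' : tail01 (splice g1 g2) s = lam (I01 `&` [set x | s < `|splice g1 g2 x|]) by [].
rewrite A1E A2E sE' ge0_muleDr ?measure_ge0//.
rewrite -(lebesgue_preimage_affine 0 two mA1).
rewrite -(lebesgue_preimage_affine (-1) two (mt _ m2)).
rewrite -measureU//.
- congr lam; apply/seteqP; rewrite /splice; split=> t /=.
    move=> []; rewrite /unit_itv/= in_itv/= => /andP[t0 t1].
    case: ifPn => [th st|]; last rewrite -leNgt => th st.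
      left; split=> /=; last by rewrite addr0.
      by rewrite in_itv/= addr0; apply/andP; split; lra.
    by right; split=> //=; rewrite /unit_itv/= in_itv/=; apply/andP; split; lra.
  move=> [[/=]|[/=]]; rewrite /unit_itv/= !in_itv/= => /andP[t0 t1].
    rewrite addr0 in t0 t1 *; move=> h.
    have th : t < 2^-1 by lra.
    by rewrite th; split=> //; apply/andP; split; lra.
  move=> h; have th : 2^-1 <= t by lra.
  by rewrite (le_gtF th); split=> //; apply/andP; split; lra.
- exact: mpre.
- by apply: mpre; exact: mt.
- apply/seteqP; split=> // t [[/=]]; rewrite /unit_itv/= !in_itv/= => /andP[t0 t1] _.
  by move=> [/= /andP[t2 t3] _]; lra.
Qed.

End tail01.

(** * Symmetric spaces through tails *)

Section symmetric_space.
Context (R : realType) (X : symmetricSpace R).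
Local Notation lam := (@lebesgue_measure R).
Local Notation I01 := (unit_itv R).
Local Notation norm := (ss_norm X).
Implicit Types f g : R -> R.

(** The form in which the symmetry of [X] is used: comparing rearrangements
    amounts to comparing tails. *)
Lemma ss_tail_le f g : X f -> measurable_fun I01 g ->
  (forall s, 0 <= s -> (tail01 g s <= tail01 f s)%E) ->
  X g /\ norm g <= norm f.
Proof.
move=> Xf mg gf; apply: ss_symm => // t t0.
have mf := ss_measurable Xf.
apply: rearr_le; first exact: rearr_ge0.
apply: le_trans (gf _ (rearr_ge0 _ _ _ _)) _.
apply: tail_rearr_le; first exact: measurable_tails01.
exact: (vanishing_tails01 mf).
Qed.

Lemma ss_le_norm f g : X f -> measurable_fun I01 g ->
  {in I01, forall x, `|g x| <= `|f x|} -> X g /\ norm g <= norm f.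
Proof.
move=> Xf mg gf; apply: ss_tail_le => // s s0; apply: tail01_le => //.
exact: ss_measurable Xf.
Qed.

Lemma ss_abs f : X f -> X (fun x => `|f x|) /\ norm (fun x => `|f x|) = norm f.
Proof.
move=> Xf; have mf := ss_measurable Xf.
have ma : measurable_fun I01 (fun x => `|f x|) by exact: measurableT_comp.
have [Xa le1] : X (fun x => `|f x|) /\ norm (fun x => `|f x|) <= norm f.
  by apply: ss_le_norm => // x _; rewrite normr_id.
split=> //; apply/eqP; rewrite eq_le le1/=.
by apply: (ss_le_norm Xa mf _).2 => x _; rewrite normr_id.
Qed.

Lemma ss_sum n (f : 'I_n -> R -> R) : (forall k, X (f k)) ->
  X (fun x => \sum_(k < n) f k x).
Proof.
elim: n f => [|n ih] f Xf.
  by under eq_fun do rewrite big_ord0; exact: ss_zero.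
under eq_fun do rewrite big_ord_recr/=.
by apply: ss_add => //; apply: ih => k.
Qed.

Lemma ss_cst (c : R) : X (cst c) /\ norm (cst c) = `|c|.
Proof.
suff [X1 n1] : X (cst 1) /\ norm (cst 1) = 1.
  have E : cst c = (fun x : R => c * cst 1 x) by apply/funext => x /=; rewrite mulr1.
  rewrite E; split; first exact: ss_scale.
  by rewrite ss_norm_scale// n1 mulr1.
pose chi := \1_(`]0, 1[%classic : set R) : R -> R.
have Xc : X chi := ss_chi01 X; have nc : norm chi = 1 := ss_norm_chi01 X.
have mchi := ss_measurable Xc.
have m1 : measurable_fun I01 (cst 1 : R -> R) by exact: measurable_cst.
have tE s : 0 <= s -> tail01 (cst 1) s = tail01 chi s.
  move=> s0; have [s1|s1] := ltP s 1; last first.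
    rewrite /tail01 /tail; congr lam; apply/seteqP; split=> x [Ix /=].
      by rewrite normr1 ltNge s1.
    by rewrite /chi indicE; case: (_ \in _); rewrite ?normr1 ?normr0 ltNge ?s1 ?s0.
  have E : lam (I01 `&` [set x | s < `|cst 1 x|]) = lam `]0, 1[%classic.
    apply: (lebesgue_between _ _ _).2 => //.
      move=> x; rewrite /unit_itv/= !in_itv/= => /andP[x0 x1].
      by rewrite normr1 s1 !ltW.
    move=> x; rewrite /unit_itv/= !in_itv/= => -[/andP[x0 x1] _].
    have [->|xn0] := eqVneq x 0; first by right; left.
    have [->|xn1] := eqVneq x 1; first by right; right.
    by left; rewrite !lt_neqAle x0 x1 xn1 eq_sym xn0.
  have E' : lam (I01 `&` [set x | s < `|chi x|]) = lam `]0, 1[%classic.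
    congr lam; apply/seteqP; split=> x /=.
      rewrite /chi indicE; case: (boolP (x \in _)) => [/set_mem//|_ [_]].
      by rewrite normr0 ltNge s0.
    move=> x01; have := x01; rewrite /chi indicE mem_set//= in_itv/= => /andP[x0 x1].
    by rewrite normr1 /unit_itv/= in_itv/= !ltW.
  exact: etrans E (esym E').
have [X1 n1] : X (cst 1) /\ norm (cst 1) <= norm chi.
  by apply: ss_tail_le => // s s0; rewrite tE.
split=> //; apply: etrans nc; apply/eqP; rewrite eq_le n1/=.
by apply: (ss_tail_le X1 mchi _).2 => s s0; rewrite tE.
Qed.

(** Squeezing [g] into either half of the interval halves its tail, and the sum of
    the two squeezed copies has the tail of [g]; each halving costs a factor 2. *)
Lemma ss_dilation f g k : X f -> measurable_fun I01 g ->
  (forall s, 0 <= s -> (tail01 g s <= (2 ^ k)%:R%:E * tail01 f s)%E) ->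
  X g /\ norm g <= (2 ^ k)%:R * norm f.
Proof.
move=> Xf; elim: k g => [|k ih] g mg gf.
  rewrite expn0 mul1r; apply: ss_tail_le => // s s0.
  by rewrite -[leRHS]mul1e gf.
pose g' := restrict01 g.
have mg' : measurable_fun setT g' by exact: measurable_restrict01.
have tg' s : tail01 g' s = tail01 g s.
  by apply: tail01_eq => x; rewrite inE => Ix; rewrite /g' restrict01E.
have m0 : measurable_fun setT (cst 0 : R -> R) by exact: measurable_cst.
have t0 s : 0 <= s -> tail01 (cst 0 : R -> R) s = 0%E.
  move=> s0; rewrite /tail01 /tail (_ : _ `&` _ = set0) ?measure0//.
  by apply/seteqP; split=> // x [_ /=]; rewrite normr0 ltNge s0.
have half s : 0 <= s ->
    ((2^-1)%:E * tail01 g' s <= (2 ^ k)%:R%:E * tail01 f s)%E.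
  move=> s0; rewrite tg'.
  apply: le_trans (lee_wpmul2l _ (gf s s0)) _; first by rewrite lee_fin.
  rewrite muleA -EFinM expnS natrM mulrA mulVf// mul1r; exact: lexx.
have [X0 n0] : X (splice g' (cst 0)) /\ norm (splice g' (cst 0)) <= (2 ^ k)%:R * norm f.
  apply: ih; first by apply: measurable_funTS; exact: measurable_splice.
  by move=> s s0; rewrite tail01_splice// t0// adde0 half.
have [X1 n1] : X (splice (cst 0) g') /\ norm (splice (cst 0) g') <= (2 ^ k)%:R * norm f.
  apply: ih; first by apply: measurable_funTS; exact: measurable_splice.
  by move=> s s0; rewrite tail01_splice// t0// add0e half.
have sE' : splice g' g' = splice g' (cst 0) \+ splice (cst 0) g'.
  by apply/funext => t; rewrite /splice/=; case: ifP; rewrite ?addr0 ?add0r.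
have [Xg ng] : X g /\ norm g <= norm (splice g' g').
  apply: ss_tail_le => //; first by rewrite sE'; exact: ss_add.
  move=> s s0; rewrite tail01_splice// tg' -[in leRHS](mul1e (tail01 g s)).
  by rewrite -ge0_muleDl// muleA -EFinD -EFinM mulVf// mul1e.
split=> //; rewrite (le_trans ng)// sE' (le_trans (ss_norm_add X0 X1))//.
by rewrite expnS natrM -mulrA (_ : 2%:R = 1 + 1 :> R)// mulrDl mul1r lerD.
Qed.

End symmetric_space.

(** * Embedding of a symmetric space into the integrable functions *)

Section embedding_in_L1.
Context (R : realType) (X : symmetricSpace R).
Local Notation lam := (@lebesgue_measure R).
Local Notation I01 := (unit_itv R).
Local Notation norm := (ss_norm X).
Implicit Types f g : R -> R.

(** This makes integrals depend on tails only, hence transfers them between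
    functions with the same tail. *)
Lemma layer_cake01 f : measurable_fun setT f ->
  (\int[lam]_(x in I01) `|f x|%:E = \int[lam]_(s in `[0%R, +oo[) tail01 f s)%E.
Proof.
move=> mf.
have ma : measurable_fun setT (fun x : measurableTypeR R => `|f x|).
  exact: measurableT_comp.
pose Y : {mfun (measurableTypeR R) >-> R} :=
  HB.pack (fun x : measurableTypeR R => `|f x|) (isMeasurableFun.Build _ _ _ _ _ ma).
have := @ge0_expectation_ccdf _ _ _ (@unif01 R) Y (fun x => normr_ge0 _).
rewrite unlock ge0_integral_unif01; last 2 first.
- exact/measurable_EFinP.
- by move=> x; rewrite lee_fin normr_ge0.
move=> ->; apply: eq_integral => s _.
apply: etrans (unif01E _) _; rewrite /tail01 /tail; congr (lam _).
by apply/seteqP; split=> x [Ix] /=; rewrite in_itv/= andbT.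
Qed.

Lemma measurable_fun_tail01 f : measurable_fun I01 f ->
  measurable_fun (`[0, +oo[%classic : set R) (tail01 f).
Proof.
move=> mf.
have mh : measurable_fun setT (fun s : R => fine (tail01 f (Num.max 0 s))).
  apply: nonincreasing_measurable => // s t st.
  have m0 (r : R) : 0 <= Num.max 0 r by rewrite le_max lexx.
  apply: fine_le.
  - by rewrite ge0_fin_numE ?measure_ge0// (le_lt_trans (tail01_le1 mf _))// ltry.
  - by rewrite ge0_fin_numE ?measure_ge0// (le_lt_trans (tail01_le1 mf _))// ltry.
  - apply: tail_anti => //; first exact: measurable_tails01.
    by rewrite ge_max le_max lexx/= le_max st orbT.
have : measurable_fun (`[0, +oo[%classic : set R) (EFin \o (fun s : R => fine (tail01 f (Num.max 0 s)))).
  by apply/measurable_EFinP; exact: measurable_funTS.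
apply: eq_measurable_fun => s; rewrite inE/= in_itv/= andbT => s0.
rewrite max_r// fineK// ge0_fin_numE ?measure_ge0//.
by rewrite (le_lt_trans (tail01_le1 mf _))// ltry.
Qed.

Definition fold_halves f (t : R) := f (t / 2) + f ((t + 1) / 2).

Let f_L f t := f (t / 2) : R.
Let f_R f t := f ((t + 1) / 2) : R.

Let spliceE f : splice (f_L f) (f_R f) = f.
Proof.
by apply/funext => t; rewrite /splice /f_L /f_R; case: ifP => _; congr f; field.
Qed.

Let mL f : measurable_fun setT f -> measurable_fun setT (f_L f).
Proof. by move=> mf; apply: measurableT_comp => //; exact: mulrr_measurable. Qed.

Let mR f : measurable_fun setT f -> measurable_fun setT (f_R f).
Proof.
move=> mf; apply: measurableT_comp => //.
by apply: measurable_funM => //; exact: measurable_funD.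
Qed.

Lemma measurable_fold_halves f : measurable_fun setT f ->
  measurable_fun setT (fold_halves f).
Proof. by move=> mf; apply: measurable_funD; [exact: mL|exact: mR]. Qed.

(** Exchanging the halves of [f] does not change its tail, and [f] plus its
    exchanged copy is a squeezed double copy of [fold_halves f]. *)
Lemma ss_fold_halves f : measurable_fun setT f -> X f ->
  X (fold_halves f) /\ norm (fold_halves f) <= 2 * norm f.
Proof.
move=> mf Xf; have ML := mL mf; have MR := mR mf.
have [X' n'] : X (splice (f_R f) (f_L f)) /\ norm (splice (f_R f) (f_L f)) <= norm f.
  apply: ss_tail_le => //; first by apply: measurable_funTS; exact: measurable_splice.
  by move=> s s0; rewrite -[in leRHS](spliceE f) !tail01_splice// addeC.
have [XB nB] : X (fold_halves f) /\
    norm (fold_halves f) <= norm (f \+ splice (f_R f) (f_L f)).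
  apply: ss_tail_le; first exact: ss_add.
    by apply: measurable_funTS; exact: measurable_fold_halves.
  move=> s s0; rewrite -[X in X \+ _](spliceE f).
  rewrite (_ : _ \+ _ = splice (fold_halves f) (fold_halves f)); last first.
    apply/funext => t; rewrite /splice/= /fold_halves; case: ifP => _ //.
    by rewrite addrC.
  have mB := measurable_fold_halves mf; rewrite tail01_splice//.
  rewrite -[in leRHS](mul1e (tail01 _ s)).
  rewrite -ge0_muleDl// muleA -EFinD -EFinM mulVf// mul1e; exact: lexx.
split=> //; rewrite (le_trans nB)// (le_trans (ss_norm_add Xf X'))//.
by rewrite (_ : 2 = 1 + 1 :> R)// mulrDl !mul1r lerD2l.
Qed.

Lemma integral_fold_halves f : measurable_fun setT f -> (forall x, 0 <= f x) ->
  (\int[lam]_(x in I01) (fold_halves f x)%:E =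
   2%:E * \int[lam]_(x in I01) (f x)%:E)%E.
Proof.
move=> mf f0; have ML := mL mf; have MR := mR mf.
have mI := @measurable_unit_itv R.
have LC g : measurable_fun setT g -> (forall x, 0 <= g x) ->
    (\int[lam]_(x in I01) (g x)%:E = \int[lam]_(s in `[0%R, +oo[) tail01 g s)%E.
  move=> mg g0; rewrite -layer_cake01//; apply: eq_integral => x _.
  by rewrite ger0_norm.
have mt g : measurable_fun setT g -> measurable_fun (`[0, +oo[%classic : set R) (tail01 g).
  by move=> mg; apply: measurable_fun_tail01; exact: measurable_funTS.
under eq_integral do rewrite EFinD.
rewrite ge0_integralD//; last 4 first.
- by move=> x _; rewrite lee_fin.
- by apply/measurable_EFinP; exact: measurable_funTS.
- by move=> x _; rewrite lee_fin.
- by apply/measurable_EFinP; exact: measurable_funTS.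
rewrite (LC (f_L f))//; last by move=> x; exact: f0.
rewrite (LC (f_R f))//; last by move=> x; exact: f0.
rewrite -ge0_integralD//; [|exact: mt..].
rewrite LC// -ge0_integralZl//; last exact: mt.
apply: eq_integral => s; rewrite inE/= in_itv/= andbT => s0.
by rewrite -[in RHS](spliceE f) tail01_splice// muleA -EFinM divff// mul1e.
Qed.

(** Folding [k] times multiplies the integral by [2 ^ k] and the norm by at most
    [2 ^ k], while the oscillation [f 0 - f 1] does not grow. Hence the folded
    function, divided by [2 ^ k], is nearly constant, and for a constant the
    norm and the integral agree. *)
Lemma integral_nonincreasing_le_norm f : measurable_fun setT f -> X f ->
  (forall x, 0 <= f x) ->
  (forall s t, 0 <= s -> s <= t -> t <= 1 -> f t <= f s) ->
  (\int[lam]_(x in I01) (f x)%:E <= (norm f)%:E)%E.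
Proof.
move=> mf Xf f0 fni.
pose B k := iter k fold_halves f.
have BP k : [/\ measurable_fun setT (B k), X (B k), forall x, 0 <= B k x,
    forall s t, 0 <= s -> s <= t -> t <= 1 -> B k t <= B k s &
    B k 0 - B k 1 = f 0 - f 1].
  elim: k => [|k [mB XB B0 Bni B01]]; first by split.
  split=> /=.
  - exact: measurable_fold_halves.
  - exact: (ss_fold_halves mB XB).1.
  - by move=> x; rewrite addr_ge0.
  - by move=> s t s0 st t1; rewrite /fold_halves lerD// Bni//; lra.
  - rewrite -B01 /fold_halves mul0r add0r (_ : (1 + 1) / 2 = 1 :> R); last by field.
    by rewrite (_ : 1 / 2 = 2^-1 :> R) ?mul1r// ; lra.
have nB k : norm (B k) <= 2 ^+ k * norm f.
  elim: k => [|k ih]; first by rewrite mul1r.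
  have [mB XB _ _ _] := BP k.
  by rewrite (le_trans (ss_fold_halves mB XB).2)// exprS -mulrA ler_wpM2l.
have iB k : (\int[lam]_(x in I01) (B k x)%:E = (2 ^+ k)%:E * \int[lam]_(x in I01) (f x)%:E)%E.
  elim: k => [|k ih]; first by rewrite mul1e.
  have [mB _ B0 _ _] := BP k.
  by rewrite integral_fold_halves// ih muleA -EFinM -exprS.
have mI := @measurable_unit_itv R.
have le0 k : (\int[lam]_(x in I01) (B k x)%:E <= (B k 0)%:E)%E.
  have [mB _ B0 Bni _] := BP k.
  apply: (@le_trans _ _ (\int[lam]_(x in I01) (cst (B k 0)%:E) x)%E).
    apply: ge0_le_integral => //.
    - by move=> x _; rewrite lee_fin.
    - by apply/measurable_EFinP; exact: measurable_funTS.
    - move=> x; rewrite /unit_itv/= in_itv/= => /andP[x0 x1].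
      by rewrite lee_fin Bni.
  by rewrite integral_cst// [X in (_ * X)%E]lebesgue_unit_itv mule1.
have le1 k : B k 1 <= norm (B k).
  have [mB XB B0 Bni _] := BP k.
  rewrite -(ger0_norm (B0 1)) -(ss_cst X (B k 1)).2.
  apply: (ss_le_norm XB _ _).2; first exact: measurable_cst.
  move=> x; rewrite inE /unit_itv/= in_itv/= => /andP[x0 x1].
  by rewrite !ger0_norm// Bni.
have key k : (\int[lam]_(x in I01) (f x)%:E <= (norm f + f 0 / 2 ^+ k)%:E)%E.
  have [_ _ _ _ B01] := BP k.
  have p0 : 0 < 2 ^+ k :> R by rewrite exprn_gt0.
  have := le0 k; rewrite iB.
  have : B k 0 <= 2 ^+ k * norm f + f 0.
    by have := f0 1; have := le1 k; have := nB k; lra.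
  move=> h1 h2.
  rewrite -(@lee_pmul2l _ (2 ^+ k)%:E)// ?lte_fin//.
  rewrite (le_trans h2)// -EFinM lee_fin (le_trans h1)// mulrDr lerD2l.
  by rewrite mulrCA divff ?mulr1// gt_eqF.
apply/lee_addgt0Pr => e e0.
have [k _ ke] : exists2 k, True & f 0 / 2 ^+ k <= e.
  exists (Num.bound (f 0 / e)) => //.
  rewrite ler_pdivrMr ?exprn_gt0// mulrC -ler_pdivrMr//.
  apply: (le_trans (ltW (archi_boundP _))); first by rewrite divr_ge0// ltW.
  by rewrite -natrX ler_nat ltnW// ltn_expl.
apply: le_trans (key k) _.
by rewrite -EFinD lee_fin lerD2l.
Qed.

Lemma tail01_eq_pos f g s : measurable_fun I01 f ->
  (forall t, 0 < t -> t <= 1 -> f t = g t) -> 0 <= s ->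
  tail01 g s = tail01 f s.
Proof.
move=> mf fg s0.
pose J : set R := (I01 `&` [set x | s < `|f x|]) `&` `]0, 1].
have mJ : measurable J by apply: measurableI => //; exact: measurable_tails01.
have near0 (h : R -> R) : (forall t, 0 < t -> t <= 1 -> f t = h t) ->
    tail01 h s = lam J.
  move=> fh; apply: (lebesgue_between mJ _ _).2.
    move=> x [[Ix /= sx]]; rewrite in_itv/= => /andP[x0 x1].
    by split=> //=; rewrite -fh.
  move=> x [Ix /= sx]; have [->|xn0] := eqVneq x 0; first by right; left.
  left; have := Ix; rewrite /unit_itv/= in_itv/= => /andP[x0 x1].
  have {}x0 : 0 < x by rewrite lt_neqAle eq_sym xn0.
  by split; [split=> //=; rewrite fh|rewrite /= in_itv/= x0].
by rewrite near0// near0.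
Qed.

Lemma rearr01_nonincreasing f s t : measurable_fun I01 f -> 0 < s -> s <= t ->
  rearr01 f t <= rearr01 f s.
Proof.
move=> mf s0 st; apply: rearr_le; first exact: rearr_ge0.
apply: le_trans (_ : s%:E <= t%:E)%E; last by rewrite lee_fin.
apply: tail_rearr_le; first exact: measurable_tails01.
exact: vanishing_tails01.
Qed.

(** The rearrangement of [f] is nonincreasing only on [`]0, +oo[]; its value at 0
    is replaced by the bound [L]. *)
Lemma integral_bounded_le_norm f (L : R) : 0 <= L -> measurable_fun setT f ->
  X f -> (forall x, 0 <= f x <= L) ->
  (\int[lam]_(x in I01) (f x)%:E <= (norm f)%:E)%E.
Proof.
move=> L0 mf Xf fL; have mf' : measurable_fun I01 f by exact: measurable_funTS.
have mr : measurable_fun I01 (rearr01 f).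
  apply: measurable_rearr; [exact: measurable_tails01|exact: vanishing_tails01].
pose g (t : R) : R := if t <= 0 then L else restrict01 (rearr01 f) t.
have mg : measurable_fun setT g.
  apply: measurable_fun_ifT => //; first exact: measurable_fun_ler.
  exact: measurable_restrict01.
have gE t : 0 < t -> t <= 1 -> rearr01 f t = g t.
  move=> t0 t1; rewrite /g leNgt t0/= restrict01E//.
  by rewrite /unit_itv/= in_itv/= ltW.
have tg s : 0 <= s -> tail01 g s = tail01 f s.
  by move=> s0; rewrite (tail01_eq_pos mr gE s0) tail01_rearr01.
have [Xg ng] : X g /\ norm g <= norm f.
  apply: ss_tail_le => //; first exact: measurable_funTS.
  by move=> s s0; rewrite tg.
have rL t : 0 < t -> rearr01 f t <= L.
  move=> t0; apply: rearr_le => //.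
  rewrite /tail (_ : _ `&` _ = set0) ?measure0 ?lee_fin ?ltW//.
  apply/seteqP; split=> // x [_ /=]; have /andP[fx0 fxL] := fL x.
  by rewrite ger0_norm// ltNge fxL.
have g0 x : 0 <= g x.
  rewrite /g; case: ifP => // _; rewrite /restrict01 patchE.
  by case: ifP => // _; exact: rearr_ge0.
have gni s t : 0 <= s -> s <= t -> t <= 1 -> g t <= g s.
  move=> s0 st t1; have [t0|t0] := leP t 0.
    by rewrite /g t0 (le_trans st t0).
  have [s0'|s0'] := leP s 0.
    by rewrite -gE// /g s0' rL.
  by rewrite -!gE ?(le_trans st)//; exact: rearr01_nonincreasing.
have := integral_nonincreasing_le_norm mg Xg g0 gni.
have LC (h : R -> R) : measurable_fun setT h -> (forall x, 0 <= h x) ->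
    (\int[lam]_(x in I01) (h x)%:E = \int[lam]_(s in `[0%R, +oo[) tail01 h s)%E.
  move=> mh h0; rewrite -layer_cake01//; apply: eq_integral => x _.
  by rewrite ger0_norm.
rewrite (LC g)// (LC f)//; last by move=> x; have /andP[] := fL x.
rewrite (_ : (\int[lam]_(s in _) tail01 g s)%E = (\int[lam]_(s in `[0%R, +oo[) tail01 f s)%E).
  by move=> h; rewrite (le_trans h)// lee_fin.
by apply: eq_integral => s; rewrite inE/= in_itv/= andbT => /tg.
Qed.

(** [X] embeds into [L_1] with constant 1; truncation and monotone convergence
    reduce this to bounded functions. *)
Lemma ss_integral_le_norm f : X f ->
  (\int[lam]_(x in I01) `|f x|%:E <= (norm f)%:E)%E.
Proof.
move=> Xf; have mf := ss_measurable Xf; have mI := @measurable_unit_itv R.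
pose h := restrict01 f; have mh : measurable_fun setT h by exact: measurable_restrict01.
pose g (n : nat) x := Num.min `|h x| n%:R.
have mg n : measurable_fun setT (g n).
  by apply: measurable_minr => //; exact: measurableT_comp.
have g0 n x : 0 <= g n x by rewrite le_min normr_ge0 ler0n.
have gn n : (\int[lam]_(x in I01) (g n x)%:E <= (norm f)%:E)%E.
  have [Xg ng] : X (g n) /\ norm (g n) <= norm f.
    apply: ss_le_norm => //; first exact: measurable_funTS.
    move=> x; rewrite inE => Ix; rewrite ger0_norm// /g /h restrict01E//.
    by rewrite ge_min lexx.
  apply: (@le_trans _ _ (norm (g n))%:E); last by rewrite lee_fin.
  apply: (@integral_bounded_le_norm _ n%:R) => // x.
  by rewrite g0 ge_min lexx orbT.
have cg x : I01 x -> limn (fun n => (g n x)%:E) = `|f x|%:E.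
  move=> Ix; apply: cvg_lim => //; apply: cvg_near_cst.
  exists (Num.bound `|h x|) => // n /= hn.
  rewrite /g min_l ?/h ?restrict01E//.
  move: hn; rewrite -(ler_nat R) => /(le_trans _); rewrite /h restrict01E//; apply.
  by rewrite ltW// archi_boundP.
have -> : (\int[lam]_(x in I01) `|f x|%:E =
    \int[lam]_(x in I01) limn (fun n => (g n x)%:E))%E.
  by apply: eq_integral => x; rewrite inE => Ix; rewrite cg.
rewrite monotone_convergence//.
- apply: lime_le; last exact: nearW.
  apply: ereal_nondecreasing_is_cvgn => m n mn; apply: ge0_le_integral => //.
  + by move=> x _; rewrite lee_fin.
  + by apply/measurable_EFinP/measurable_funTS; exact: mg.
  + by apply/measurable_EFinP/measurable_funTS; exact: mg.
  + by move=> x _; rewrite lee_fin le_min !ge_min lexx/= ler_nat mn orbT.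
- by move=> n; apply/measurable_EFinP/measurable_funTS; exact: mg.
- by move=> n x _; rewrite lee_fin.
- by move=> x _ m n mn; rewrite lee_fin le_min !ge_min lexx/= ler_nat mn orbT.
Qed.

End embedding_in_L1.

(** * The product space and the tail of the Kruglov operator *)

Section uniform_on_R.
Context (R : realType).

(** The same measure for the measurable structure of [R] in which the laws of
    random variables are formed. *)
Definition unifR : set R -> \bar R := @unif01 R.

Let unifR_0 : unifR set0 = 0%E.
Proof. exact: measure0. Qed.

Let unifR_ge0 A : (0 <= unifR A)%E.
Proof. exact: measure_ge0. Qed.

Let unifR_sigma_additive : semi_sigma_additive unifR.
Proof. exact: (@measure_semi_sigma_additive _ _ _ (@unif01 R)). Qed.

HB.instance Definition _ := isMeasure.Build _ _ _ unifR
  unifR_0 unifR_ge0 unifR_sigma_additive.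

Let unifR_setT : unifR setT = 1%E.
Proof. exact: (@probability_setT _ _ _ (@unif01 R)). Qed.

HB.instance Definition _ := Measure_isProbability.Build _ _ _ unifR unifR_setT.

End uniform_on_R.

Section product_space.
Context (R : realType) (P : probability (seq_space R) R).
Hypothesis prodP : is_product_measure P.
Local Notation lam := (@lebesgue_measure R).
Local Notation I01 := (unit_itv R).

Definition coord (i : nat) (w : seq_space R) : R := w i.

Lemma measurable_coord i : measurable_fun setT (coord i).
Proof.
move=> _ A mA; rewrite setTI; apply: sub_sigma_algebra.
by exists i, A.
Qed.

HB.instance Definition _ i := isMeasurableFun.Build _ _ _ _ (coord i) (measurable_coord i).

Lemma P_coord i (A : set R) : measurable A -> P (coord i @^-1` A) = unif01 A.
Proof.
move=> mA; rewrite unif01E.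
have mA' j : measurable (if j == i then A else setT) by case: ifP.
have := prodP i.+1 mA'.
rewrite (_ : [set w : nat -> R | _] = coord i @^-1` A); last first.
  apply/seteqP; split=> w /=; first by move=> /(_ i (ltnSn i)); rewrite eqxx.
  by move=> Aw j _; case: eqP => // ->.
move=> ->; rewrite big_ord_recr/= eqxx big1 ?mul1e// => j _.
by rewrite ltn_eqF//= setIT lebesgue_unit_itv.
Qed.

Lemma measurable_unit_cube : measurable (unit_cube R).
Proof.
rewrite (_ : unit_cube R = \bigcap_i (coord i @^-1` I01)); last first.
  by apply/seteqP; split=> w h; [move=> i _; exact: h|move=> i; exact: (h i I)].
apply: bigcapT_measurable => i; rewrite -[_ @^-1` _]setTI.
by apply: measurable_coord => //; exact: measurable_unit_itv.
Qed.

Lemma P_unit_cubeC : P (~` unit_cube R) = 0%E.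
Proof.
have mC := measurableC measurable_unit_cube.
apply/negligibleP => //.
rewrite (_ : ~` _ = \bigcup_i (coord i @^-1` (~` I01))); last first.
  apply/seteqP; split=> w.
    by move=> /existsNP[i wi]; exists i.
  by move=> [i _ wi] h; apply: wi; exact: h.
apply: negligible_bigcup => i; apply/negligibleP.
  rewrite -[_ @^-1` _]setTI; apply: measurable_coord => //.
  by apply: measurableC; exact: measurable_unit_itv.
apply: etrans (P_coord i (measurableC (@measurable_unit_itv R))) _.
by rewrite unif01E setICr measure0.
Qed.

Lemma P_setI_unit_cube A : measurable A -> P (unit_cube R `&` A) = P A.
Proof.
move=> mA; have mC := measurable_unit_cube.
rewrite -[in RHS](setTI A) -(setUv (unit_cube R)) setIUl measureU//.
- rewrite [X in (_ + X)%E](_ : _ = 0%E) ?adde0//.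
  apply/eqP; rewrite eq_le measure_ge0 andbT -P_unit_cubeC le_measure ?inE//.
    by apply: measurableI => //; exact: measurableC.
  exact: measurableC.
- exact: measurableI.
- by apply: measurableI => //; exact: measurableC.
- by rewrite setIACA setICr set0I.
Qed.

Section compound.
Variables (B : nat -> set R) (phi : {mfun R >-> R}).
Hypothesis kB : kruglov_sets B.

(** The terms of the random sum that defines the Kruglov operator. *)
Definition jump (i : nat) : {mfun (seq_space R) >-> R} := phi \o coord i.+1.

Let Y m (i : nat) : {mfun (seq_space R) >-> R} :=
  if (i < m)%N then jump i else coord 0.

(** The coordinate 0, which selects the set [B m], is put after the first [m]
    jumps, so that it is the last member of an independent family. *)
Lemma independent_jumps_clock m : mutually_independent P m.+1 (Y m).
Proof.
move=> A mA.
pose A' (j : nat) : set R := if j is j'.+1 then phi @^-1` A j' else A m.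
have mphiA i : measurable (phi @^-1` A i).
  by rewrite -[_ @^-1` _]setTI; exact: measurable_funP.
have mA' j : measurable (A' j) by case: j => [|j] /=.
rewrite (_ : [set x | _] = [set w : nat -> R | forall j, (j < m.+1)%N -> A' j (w j)]); last first.
  apply/seteqP; split=> w /= h.
    case=> [_|j]; first by have := h m (ltnSn m); rewrite /Y ltnn.
    by rewrite ltnS => jm; have := h j (ltnW jm); rewrite /Y jm.
  move=> i; rewrite ltnS leq_eqVlt => /orP[/eqP->|im].
    by rewrite /Y ltnn; exact: (h 0%N).
  by rewrite /Y im; exact: (h i.+1).
rewrite prodP// big_ord_recl big_ord_recr/= muleC; congr (_ * _)%E.
  apply: eq_bigr => i _; rewrite /Y ltn_ord/= -unif01E -(P_coord i.+1)//.
by rewrite /Y ltnn -unif01E -(P_coord 0).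
Qed.

Lemma independent_jumps n : mutually_independent P n jump.
Proof.
move=> A mA.
have /(mutually_independent_le (leqnSn n)) := @independent_jumps_clock n.
move=> /(_ A mA); rewrite (_ : [set x | _] = [set x | forall i, (i < n)%N -> A i (jump i x)]).
  by move=> ->; apply: eq_bigr => i _; rewrite /Y ltn_ord.
by apply/seteqP; split=> w h i im; have := h i im; rewrite /Y im.
Qed.

Lemma integral_jump i (g : R -> \bar R) : nnmeasurable g ->
  (\int[P]_w g (jump i w) = \int[distribution (@unifR R) phi]_y g y)%E.
Proof.
move=> [mg g0].
rewrite ge0_integral_distribution//.
have mgp : measurable_fun setT (g \o phi) by exact: measurableT_comp.
transitivity (\int[pushforward P (coord i.+1)]_y (g \o phi) y)%E.
  by rewrite ge0_integral_pushforward// => y _; exact: g0.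
by apply: eq_measure_integral => A mA _; exact: P_coord.
Qed.

Lemma kruglovE m w : (0 < m)%N -> B m (w 0%N) ->
  kruglov B phi w = \sum_(i < m) jump i w.
Proof.
move=> m0 Bm; rewrite /kruglov; apply: cvg_lim => //; apply: cvg_near_cst.
exists m.+1 => // N /= mN.
rewrite (bigD1_seq m) ?iota_uniq ?mem_index_iota ?m0//=.
rewrite [X in _ + X]big1_seq ?addr0; last first.
  move=> n; rewrite mem_index_iota => /andP[nm /andP[n0 _]].
  apply: big1 => k _; rewrite indicE memNset ?mulr0// => Bn.
  move/eqP: nm; apply; have [tB _] := kB.
  by apply: tB => //; exists (w 0%N).
rewrite big_add1/= big_mkord; apply: eq_bigr => i _.
by rewrite indicE mem_set// mulr1.
Qed.

Lemma kruglov_out w : (forall m, (0 < m)%N -> ~ B m (w 0%N)) ->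
  kruglov B phi w = 0.
Proof.
move=> nB; rewrite /kruglov; apply: cvg_lim => //; apply: cvg_near_cst.
apply: nearW => N; apply: big1_seq => n.
rewrite mem_index_iota => /andP[_ /andP[n0 _]]; apply: big1 => k _.
by rewrite indicE memNset ?mulr0//; exact: nB.
Qed.

Let mB n : (0 < n)%N -> measurable (B n).
Proof. by move=> n0; have [_ /(_ n n0)[]] := kB. Qed.

Let piece (s : R) m : set (seq_space R) :=
  coord 0 @^-1` B m.+1 `&` [set w | s < `|\sum_(i < m.+1) jump i w|].

Let mpiece s m : measurable (piece s m).
Proof.
apply: measurableI.
  by rewrite -[_ @^-1` _]setTI; apply: measurable_coord => //; exact: mB.
have mS : measurable_fun setT (fun w => `|\sum_(i < m.+1) jump i w|).
  apply: measurableT_comp => //; apply: measurable_sum => i.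
  exact: measurable_funP.
have := mS measurableT _ (@measurable_itv R `]s, +oo[).
by rewrite setTI; congr measurable; apply/seteqP; split=> w /=; rewrite in_itv/= andbT.
Qed.

Let superlevelE (s : R) : 0 <= s ->
  unit_cube R `&` [set w | s < `|kruglov B phi w|] =
  unit_cube R `&` \bigcup_m piece s m.
Proof.
move=> s0; congr (_ `&` _); apply/seteqP; split=> w /=; last first.
  by move=> [m _ [Bw sw]]; rewrite (@kruglovE m.+1).
move=> sw; have [[m [m0 Bm]]|nB] := pselect (exists m, (0 < m)%N /\ B m (w 0%N)).
  exists m.-1 => //; rewrite /piece prednK//; split=> //=.
  by rewrite -kruglovE.
exfalso; move: sw; rewrite kruglov_out ?normr0 ?ltNge ?s0//.
by move=> m m0 Bm; apply: nB; exists m.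
Qed.

Lemma measurable_tails_kruglov : measurable_tails (unit_cube R) (kruglov B phi).
Proof.
move=> s s0; rewrite superlevelE//; apply: measurableI.
  exact: measurable_unit_cube.
by apply: bigcupT_measurable => m; exact: mpiece.
Qed.

(** The events that coordinate 0 lies in [B m.+1] are disjoint and independent of
    the jumps. *)
Lemma sum_le_tail_kruglov n (s : R) : 0 <= s ->
  (\sum_(m < n) ((expR 1 * (m.+1)`!%:R)^-1)%R%:E *
     P [set w | (s < `|\sum_(i < m.+1) jump i w|)%R] <=
   tail P (unit_cube R) (kruglov B phi) s)%E.
Proof.
move=> s0; rewrite /tail superlevelE//.
have tp : trivIset setT (piece s).
  have [tB _] := kB; apply/trivIsetP => i j _ _ ij.
  have /trivIsetP/(_ i.+1 j.+1) := tB; rewrite /= eqSS => /(_ isT isT ij) Bij.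
  apply/seteqP; split=> // w [[Bi _] [Bj _]].
  by have : (B i.+1 `&` B j.+1) (w 0%N) by []; rewrite Bij.
have mU : measurable (\bigcup_m piece s m).
  by apply: bigcupT_measurable => m; exact: mpiece.
rewrite -[leRHS]/(P (unit_cube R `&` \bigcup_m piece s m)) P_setI_unit_cube//.
apply: (@le_trans _ _ (P (\big[setU/set0]_(m < n) piece s m))); last first.
  apply: le_measure; rewrite ?inE//; first by apply: bigsetU_measurable => i _; exact: mpiece.
  by apply: bigsetU_bigcup.
rewrite measure_semi_additive_ord_I; first last.
- by apply: bigsetU_measurable => i _; exact: mpiece.
- exact: sub_trivIset tp.
- by move=> k _; exact: mpiece.
apply: lee_sum => m _.
have mS : measurable_fun setT (fun w => `|\sum_(i < m.+1) jump i w|).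
  apply: measurableT_comp => //; apply: measurable_sum => i.
  exact: measurable_funP.
have mY := @independent_jumps_clock m.+1.
have := independent_sum_last mY.
move=> /(_ [set y : R | s < `|y|] (B m.+1)).
have mn : measurable [set y : R | s < `|y|].
  have := @normr_measurable R setT measurableT _ (@measurable_itv R `]s, +oo[).
  by rewrite setTI; congr measurable; apply/seteqP; split=> w /=; rewrite in_itv/= andbT.
move=> /(_ mn (mB (ltn0Sn m))).
have YE : (\sum_(i < m.+1) Y m.+1 i) @^-1` [set y : R | s < `|y|] =
    [set w | s < `|\sum_(i < m.+1) jump i w|].
  have -> : \sum_(i < m.+1) Y m.+1 i = \sum_(i < m.+1) jump i.
    by apply: eq_bigr => i _; rewrite /Y ltn_ord.
  by apply/seteqP; split=> w /=; rewrite mfun_sum.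
have Y0 : Y m.+1 m.+1 @^-1` B m.+1 = coord 0 @^-1` B m.+1.
  by rewrite /Y ltnn.
rewrite YE Y0 setIC => indep.
rewrite -[leRHS]/(P (coord 0 @^-1` B m.+1 `&` [set w | s < `|\sum_(i < m.+1) jump i w|])).
rewrite indep muleC P_coord; last exact: mB.
have [_ /(_ m.+1 isT)[_ BI BE]] := kB.
by rewrite unif01E (setIidr BI) BE.
Qed.

End compound.
End product_space.

(** * The Kruglov operator on a symmetric space *)

Section kruglov_operator.
Context (R : realType) (P : probability (seq_space R) R) (B : nat -> set R).
Context (X : symmetricSpace R).
Hypotheses (prodP : is_product_measure P) (kB : kruglov_sets B)
  (bK : kruglov_bounded P B X).
Local Notation lam := (@lebesgue_measure R).
Local Notation I01 := (unit_itv R).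
Local Notation norm := (ss_norm X).
Local Notation K := (kruglov_norm P B X).
Local Notation kr := (kruglov_rearr P B).

(** Any power of 2 above [e] would do: it is the constant that [ss_dilation]
    pays for the normalization [1 / (e m!)] of the sets [B m]. *)
Lemma expR1_le4 : expR 1 <= 4 :> R.
Proof.
have h : 2^-1 <= expR (- 2^-1) :> R.
  by rewrite (le_trans _ (expR_ge1Dx _))//; lra.
have h2 : expR 2^-1 <= 2 :> R.
  by rewrite -[2^-1]opprK expRN invf_ple ?posrE ?expR_gt0.
have -> : expR 1 = expR 2^-1 * expR 2^-1 :> R.
  by rewrite -expRD; congr expR; lra.
have -> : 4 = 2 * 2 :> R by lra.
by rewrite ler_pM ?expR_ge0.
Qed.

Lemma invfact_le_kruglov m :
  ((m.+1`!%:R^-1)%:E <= 4%:E * ((expR 1 * m.+1`!%:R)^-1)%:E :> \bar R)%E.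
Proof.
rewrite -EFinM lee_fin invfM mulrA ler_peMl ?invr_ge0 ?ler0n//.
by rewrite ler_pdivlMr ?expR_gt0// mul1r expR1_le4.
Qed.

Lemma tail01_kruglov (phi : {mfun R >-> R}) s : 0 <= s ->
  tail01 (kr phi) s = tail P (unit_cube R) (kruglov B phi) s.
Proof.
move=> s0; have mC := @measurable_unit_cube R.
have mt := measurable_tails_kruglov phi kB.
rewrite /tail01 tail_rearr//.
- apply/min_idPl; apply: (le_trans _ (probability_le1 P mC)).
  by apply: le_measure; rewrite ?inE//; exact: mt.
- apply: finite_vanishing_tails => //.
  by rewrite (le_lt_trans (probability_le1 P mC))// ltry.
Qed.

Lemma norm_kruglov_le1 phi : X phi -> norm phi <= 1 -> norm (kr phi) <= K.
Proof.
by move=> Xp np; apply: ub_le_sup; [exact: bK.2|exists phi].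
Qed.

Lemma kruglovZ (phi : {mfun R >-> R}) (c : R) w :
  kruglov B (fun x => c * phi x) w = c * kruglov B phi w.
Proof.
have mc : measurable_fun setT (fun x => c * phi x).
  by apply: measurable_funM => //; exact: measurable_funP.
pose psi : {mfun R >-> R} := HB.pack (fun x => c * phi x)
  (isMeasurableFun.Build _ _ _ _ _ mc).
have [[m [m0 Bm]]|nB] := pselect (exists m, (0 < m)%N /\ B m (w 0%N)).
  rewrite (kruglovE psi kB m0 Bm) (kruglovE phi kB m0 Bm) mulr_sumr.
  by apply: eq_bigr.
have out : forall m, (0 < m)%N -> ~ B m (w 0%N).
  by move=> m m0 Bm; apply: nB; exists m.
by rewrite (kruglov_out psi out) (kruglov_out phi out) mulr0.
Qed.

Lemma kruglov_norm_ge0 : 0 <= K.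
Proof.
have [X1 n1] := ss_cst X 1.
apply: (le_trans _ (norm_kruglov_le1 X1 _)); last by rewrite n1 normr1.
by apply: ss_norm_ge0; exact: bK.1.
Qed.

(** Homogeneity of the operator. The scaling is by a number slightly above
    [norm phi], which may be zero. *)
Lemma norm_kruglov_le (phi : {mfun R >-> R}) : X phi ->
  norm (kr phi) <= K * norm phi.
Proof.
move=> Xp.
have key (c : R) : 0 < c -> norm phi <= c -> norm (kr phi) <= c * K.
  move=> c0 pc.
  have mc : measurable_fun setT (fun x => c^-1 * phi x).
    by apply: measurable_funM => //; exact: measurable_funP.
  pose psi : {mfun R >-> R} := HB.pack (fun x => c^-1 * phi x)
    (isMeasurableFun.Build _ _ _ _ _ mc).
  have Xpsi : X psi by exact: ss_scale.
  have npsi : norm psi <= 1.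
    rewrite (ss_norm_scale _ Xp) ger0_norm ?invr_ge0 ?(ltW c0)//.
    by rewrite ler_pdivrMl// mulr1.
  have Xk : X (kr psi) := bK.1 _ Xpsi.
  have Xck : X (fun x => c * kr psi x) by exact: ss_scale.
  have Xkp : X (kr phi) := bK.1 _ Xp.
  have [_ le1] : X (kr phi) /\ norm (kr phi) <= norm (fun x => c * kr psi x).
    apply: ss_tail_le => //; first exact: ss_measurable Xkp.
    move=> s s0.
    have -> : tail01 (fun x => c * kr psi x) s = tail01 (kr psi) (s / c).
      rewrite /tail01 /tail; congr (lam (_ `&` _)); apply/seteqP.
      by split=> x /=; rewrite normrM (gtr0_norm c0) ltr_pdivrMr// mulrC.
    rewrite !tail01_kruglov ?divr_ge0 ?(ltW c0)// /tail.
    rewrite (_ : [set x | s < `|kruglov B phi x|] =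
        [set x | s / c < `|kruglov B psi x|]) //.
    apply/seteqP; split=> w /=; rewrite kruglovZ normrM gtr0_norm ?invr_gt0//;
      by rewrite mulrC ltr_pM2l ?invr_gt0.
  rewrite (le_trans le1)// ss_norm_scale// gtr0_norm// ler_pM2l//.
  exact: norm_kruglov_le1.
apply/ler_addgt0Pr => e e0.
have K0 := kruglov_norm_ge0.
have e1 : 0 < e / (K + 1) by rewrite divr_gt0// ltr_wpDl.
have := key (norm phi + e / (K + 1)) _ _.
rewrite ltr_wpDl// ?ss_norm_ge0// lerDl ltW// => /(_ isT isT) h.
rewrite (le_trans h)// mulrDl mulrC lerD2l mulrAC ler_pdivrMr ?ltr_wpDl//.
by rewrite ler_pM2l// lerDl.
Qed.

Let one : {mfun R >-> R} := cst 1.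

(** [K 1] equals [m] on the event that coordinate 0 lies in [B m]. *)
Lemma tail01_kruglov_one_ge m (r : R) : 0 <= r -> r < m.+1%:R ->
  (((expR 1 * m.+1`!%:R)^-1)%:E <= tail01 (kr one) r)%E.
Proof.
move=> r0 rm; rewrite tail01_kruglov//.
apply: le_trans (sum_le_tail_kruglov prodP one kB m.+1 r0).
rewrite big_ord_recr/=.
set Q := [set w | _].
have -> : Q = setT.
  apply/seteqP; split=> // w _; rewrite /Q/=.
  by rewrite sumr_const card_ord ger0_norm ?ler0n.
rewrite probability_setT mule1 leeDr//.
by apply: sume_ge0 => i _; rewrite mule_ge0// lee_fin invr_ge0 mulr_ge0// expR_ge0.
Qed.

(** [K 1 >= 1] on [B 1], a set of measure [1/e >= 1/4]. *)
Lemma one_le_kruglov_norm : 1 <= 4 * K.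
Proof.
have [X1 n1] := ss_cst X 1.
have Xk : X (kr one) := bK.1 _ X1.
have m1 : measurable_fun I01 (cst 1 : R -> R) by exact: measurable_cst.
have ht (s : R) : 0 <= s -> (tail01 (cst 1%R : R -> R) s <= (2 ^ 2)%:R%:E * tail01 (kr one) s)%E.
  move=> s0; have [s1|s1] := ltP s 1; last first.
    rewrite [leLHS](_ : _ = 0%E) ?mule_ge0// ?measure_ge0//.
    rewrite /tail01 /tail (_ : _ `&` _ = set0) ?measure0//.
    by apply/seteqP; split=> // x [_ /=]; rewrite normr1 ltNge s1.
  apply: (@le_trans _ _ (4%:E * ((expR 1 * (0.+1)`!%:R)^-1)%:E)%E).
    apply: le_trans (invfact_le_kruglov 0).
    by rewrite invr1; exact: tail01_le1.
  by apply: lee_wpmul2l => //; exact: tail01_kruglov_one_ge.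
have [_] := ss_dilation Xk m1 ht.
rewrite n1 normr1 => h; apply: (le_trans h); rewrite ler_wpM2l//.
by have := norm_kruglov_le X1; rewrite n1 normr1 mulr1.
Qed.

(** With [m] the integer part of [s / (2 b)] plus one, the tail of [g] at [s] is at
    most [2 / m!], which is at most 8 times the tail of [K 1] at [s / (2 b)]. *)
Lemma norm_le_poisson_tail (g : R -> R) (b : R) : 0 < b -> measurable_fun I01 g ->
  (forall n, (0 < n)%N ->
    (lam (I01 `&` [set x | (b * n%:R <= `|g x|)%R]) <= (2 / n`!%:R)%R%:E)%E) ->
  X g /\ norm g <= 16 * b * K.
Proof.
move=> b0 mg gtail.
have [X1 n1] := ss_cst X 1.
have Xk : X (kr one) := bK.1 _ X1.
have Xbk : X (fun x => (2 * b) * kr one x) by exact: ss_scale.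
have bb0 : 0 < 2 * b by rewrite mulr_gt0.
suff ht (s : R) : 0 <= s -> (tail01 g s <=
    (2 ^ 3)%:R%:E * tail01 (fun x => (2 * b) * kr one x)%R s)%E.
  have [Xg ng] := ss_dilation Xbk mg ht.
  split=> //; apply: (le_trans ng); rewrite ss_norm_scale// gtr0_norm//.
  have := norm_kruglov_le X1; rewrite n1 normr1 mulr1 => h.
  rewrite (_ : 16 * b = 8 * (2 * b)); last by ring.
  by rewrite -mulrA; apply: ler_wpM2l => //; apply: ler_wpM2l => //; exact: ltW.
move=> s0.
have -> : tail01 (fun x => 2 * b * kr one x) s = tail01 (kr one) (s / (2 * b)).
  rewrite /tail01 /tail; congr (lam (_ `&` _)); apply/seteqP.
  by split=> x /=; rewrite normrM (gtr0_norm bb0) ltr_pdivrMr// mulrC.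
set r := s / (2 * b).
have r0 : 0 <= r by rewrite divr_ge0// ltW.
have sE : s = 2 * b * r by rewrite /r mulrC divfK// gt_eqF.
pose m := Num.truncn r.
have /andP[mr rm] : m%:R <= r < m.+1%:R by exact: truncn_itv.
apply: (@le_trans _ _ (2 / m.+1`!%:R)%:E).
  have [m0|m0] := posnP m.
    rewrite m0 divr1; apply: (le_trans (tail01_le1 mg s0)).
    by rewrite lee_fin; lra.
  apply: le_trans (gtail m.+1 isT); apply: le_measure; rewrite ?inE.
  - exact: measurable_tails01.
  - rewrite (_ : _ `&` _ = I01 `&` (fun x => `|g x|) @^-1` `[b * m.+1%:R, +oo[).
      have ma : measurable_fun I01 (fun x => `|g x|) by exact: measurableT_comp.
      by apply: ma => //; exact: measurable_unit_itv.
    by apply/seteqP; split=> x /=; rewrite in_itv/= andbT.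
  - move=> x [Ix /= sx]; split=> //=; rewrite (le_trans _ (ltW sx))//.
    rewrite sE -mulrA mulrCA ler_wpM2l ?(ltW b0)//.
    have m1 : 1 <= m%:R :> R by rewrite ler1n.
    by rewrite -[m.+1%:R]natr1 mulr_natl mulr2n lerD// (le_trans m1).
apply: (@le_trans _ _ (8%:E * ((expR 1 * m.+1`!%:R)^-1)%:E)%E).
  have := invfact_le_kruglov m; rewrite -!EFinM !lee_fin; lra.
by apply: lee_wpmul2l => //; exact: tail01_kruglov_one_ge.
Qed.

End kruglov_operator.

(** * The disjointification and its rearrangement *)

Lemma natr_eq_of_lt (R : realType) (i j : nat) :
  i%:R < j%:R + 1 :> R -> j%:R < i%:R + 1 :> R -> i = j.
Proof.
rewrite !natr1 !ltr_nat !ltnS => ij ji.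
by apply/eqP; rewrite eqn_leq ij ji.
Qed.

Section disjointification_tail.
Context (R : realType) (n : nat) (f : 'I_n -> R -> R).
Hypothesis mf : forall k, measurable_fun (unit_itv R) (f k).
Local Notation lam := (@lebesgue_measure R).
Local Notation I01 := (unit_itv R).
Local Notation halfline := (`]0, +oo[%classic : set R).
Local Notation F := (disjointification f).

Let slab (s : R) (k : 'I_n) : set R :=
  (fun t => 1 * t + - k%:R) @^-1` (`]0, 1[ `&` (I01 `&` [set x | s < `|f k x|])).

Let slabE s k t : slab s k t = (0 < t - k%:R < 1 /\ s < `|f k (t - k%:R)|) :> Prop.
Proof.
rewrite /slab/= mul1r in_itv/=; apply/propext; split=> [[h [_ sf]]//|[h sf]].
split=> //; split=> //; rewrite /unit_itv/= in_itv/=.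
by case/andP: h => h0 h1; rewrite !ltW.
Qed.

Let mbase s k : 0 <= s -> measurable (`]0, 1[ `&` (I01 `&` [set x | s < `|f k x|])).
Proof. by move=> s0; apply: measurableI => //; exact: measurable_tails01. Qed.

Let mslab s k : 0 <= s -> measurable (slab s k).
Proof.
move=> s0; have mh : measurable_fun setT (fun t : R => 1 * t + - k%:R).
  by apply: measurable_funD => //; exact: mulrl_measurable.
by rewrite -[slab s k]setTI; apply: mh => //; exact: mbase.
Qed.

Let lam_slab s k : 0 <= s -> lam (slab s k) = tail01 (f k) s.
Proof.
move=> s0; rewrite /slab lebesgue_preimage_affine//; last exact: mbase.
rewrite invr1 mul1e; apply/esym.
apply: (lebesgue_between (mbase k s0) _ _).2; first by move=> x [].
move=> x [Ix sx]; have [->|xn0] := eqVneq x 0; first by right; left.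
have [->|xn1] := eqVneq x 1; first by right; right.
left; split=> //=; move: Ix; rewrite /unit_itv/= !in_itv/= => /andP[x0 x1].
by rewrite !lt_neqAle x0 x1 xn1 eq_sym xn0.
Qed.

Let slab_disj s : trivIset setT (slab s).
Proof.
apply/trivIsetP => i j _ _ ij; apply/seteqP; split=> // t [].
rewrite !slabE => -[/andP[i0 i1] _] [/andP[j0 j1] _].
by move/eqP: ij; apply; apply/val_inj/(@natr_eq_of_lt R); rewrite /=; lra.
Qed.

Lemma disjointificationE (k : 'I_n) t : 0 < t - k%:R < 1 -> F t = f k (t - k%:R).
Proof.
move=> /andP[k0 k1]; rewrite /disjointification (bigD1 k)//= big1 ?addr0; last first.
  move=> j jk; rewrite indicE memNset ?mulr0//= in_itv/= => /andP[j0 j1].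
  move: j1; rewrite -natr1 => j1.
  by move/eqP: jk; apply; apply/val_inj/(@natr_eq_of_lt R); rewrite /=; lra.
rewrite indicE mem_set ?mulr1//= in_itv/= -natr1.
by apply/andP; split; lra.
Qed.

Let superlevelP s : 0 <= s ->
  measurable (halfline `&` [set x | s < `|F x|]) /\
  lam (halfline `&` [set x | s < `|F x|]) = (\sum_(k < n) tail01 (f k) s)%E.
Proof.
move=> s0.
have mU : measurable (\big[setU/set0]_(k < n) slab s k).
  by apply: bigsetU_measurable => k _; exact: mslab.
have -> : (\sum_(k < n) tail01 (f k) s)%E = lam (\big[setU/set0]_(k < n) slab s k).
  rewrite measure_semi_additive_ord//; last by move=> k; exact: mslab.
  by apply: eq_bigr => k _; exact/esym/lam_slab.
pose N : set R := [set k%:R | k in `I_n.+1].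
apply: (@lebesgue_between_finite _ _ _ N) => //.
- exact/finite_image/finite_II.
- move=> t; rewrite -bigcup_seq/= => -[k _]; rewrite slabE => -[/andP[k0 k1] sf].
  split; last by rewrite /= (disjointificationE (k := k)) ?k0.
  by rewrite /= in_itv/= andbT; have := ler0n R k; lra.
- move=> t [_ /= sF].
  have [Nt|nNt] := pselect (N t); first by right.
  left; rewrite -bigcup_seq/=.
  have [k kt] : exists k : 'I_n, k%:R <= t <= k.+1%:R.
    apply: contrapT => nk; move: sF; rewrite /disjointification big1 ?normr0 ?ltNge ?s0//.
    move=> k _; rewrite indicE memNset ?mulr0//= in_itv/= => kt.
    by apply: nk; exists k.
  have /andP[k0 k1] := kt.
  have k0' : k%:R < t.
    rewrite lt_neqAle k0 andbT; apply/eqP => kt'; apply: nNt.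
    by exists (k : nat) => //=; rewrite ltnS ltnW.
  have k1' : t < k.+1%:R.
    rewrite lt_neqAle k1 andbT; apply/eqP => kt'; apply: nNt.
    by exists k.+1 => //=; rewrite ltnS.
  have k01 : 0 < t - k%:R < 1 by move: k1'; rewrite -natr1 => k1'; apply/andP; split; lra.
  exists k; first by rewrite /= mem_index_enum.
  by rewrite slabE; split=> //; rewrite -disjointificationE.
Qed.

Lemma measurable_tails_disjointification : measurable_tails halfline F.
Proof. by move=> s /superlevelP[]. Qed.

(** The shifted copies of the [f k] live on intervals that overlap only at
    integers. *)
Lemma tail_disjointification s : 0 <= s ->
  tail lam halfline F s = (\sum_(k < n) tail01 (f k) s)%E.
Proof. by move=> /superlevelP[]. Qed.

End disjointification_tail.

Section disjointification_rearrangement.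
Context (R : realType) (X : symmetricSpace R) (n : nat) (f : 'I_n -> R -> R).
Hypothesis Xf : forall k, X (f k).
Local Notation lam := (@lebesgue_measure R).
Local Notation I01 := (unit_itv R).
Local Notation norm := (ss_norm X).
Local Notation halfline := (`]0, +oo[%classic : set R).
Local Notation F := (disjointification f).

Let mf k : measurable_fun I01 (f k).
Proof. exact: ss_measurable (Xf k). Qed.

Let W x := \sum_(k < n) `|f k x|.

Let XW : X W.
Proof. by apply: ss_sum => k; exact: (ss_abs (Xf k)).1. Qed.

Let sum_tails_le s : 0 <= s ->
  (\sum_(k < n) tail01 (f k) s <= n%:R%:E * tail01 W s)%E.
Proof.
move=> s0.
have sumE m (c : \bar R) : (0 <= c)%E -> (\sum_(k < m) c = m%:R%:E * c)%E.
  move=> c0; elim: m => [|m ih]; first by rewrite big_ord0 mul0e.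
  by rewrite big_ord_recr/= ih -natr1 EFinD ge0_muleDl ?lee_fin// mul1e.
rewrite -sumE ?measure_ge0//; apply: lee_sum => k _.
apply: tail01_le => //; first exact: ss_measurable XW.
move=> x _; rewrite [leRHS]ger0_norm ?sumr_ge0// /W (bigD1 k)//=.
by rewrite lerDl sumr_ge0.
Qed.

Lemma vanishing_tails_disjointification : vanishing_tails lam halfline F.
Proof.
move=> t t0; have mW := ss_measurable XW.
have [|s s0 st] := vanishing_tails01 mW (t := t / n.+1%:R); first by rewrite divr_gt0.
exists s => //; rewrite tail_disjointification//.
apply: (le_trans (sum_tails_le s0)).
apply: (@le_trans _ _ (n%:R%:E * (t / n.+1%:R)%:E)%E).
  by apply: lee_wpmul2l => //; rewrite lee_fin.
rewrite -EFinM lee_fin mulrA ler_pdivrMr// mulrC ler_wpM2l ?(ltW t0)//.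
by rewrite ler_nat.
Qed.

(** The function [F^* chi_[0,1]] of the statement. *)
Definition head_rearr t := disjointification_rearr f t * \1_I01 t.

Lemma head_rearr_ge0 t : 0 <= head_rearr t.
Proof. by rewrite /head_rearr mulr_ge0//; exact: rearr_ge0. Qed.

Lemma tail01_head_rearr s : 0 <= s ->
  tail01 head_rearr s = Order.min (\sum_(k < n) tail01 (f k) s)%E 1%E.
Proof.
move=> s0; rewrite -tail_disjointification// -tail_rearr//; last 2 first.
- exact: measurable_tails_disjointification.
- exact: vanishing_tails_disjointification.
by apply: tail01_eq => x Ix; rewrite /head_rearr indicE Ix mulr1.
Qed.

Lemma measurable_head_rearr : measurable_fun setT head_rearr.
Proof.
have mr : measurable_fun I01 (disjointification_rearr f).
  apply: measurable_rearr; first exact: measurable_tails_disjointification.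
  exact: vanishing_tails_disjointification.
have := measurable_restrict01 mr.
by rewrite (_ : restrict01 _ = head_rearr)//; rewrite /restrict01 patch_indic.
Qed.

(** The tail of [F] is at most [n] times that of the sum of the [|f k|], and
    [n <= 2 ^ n]. *)
Lemma ss_head_rearr : X head_rearr.
Proof.
apply: (ss_dilation (k := n) XW _ _).1.
  by apply: measurable_funTS; exact: measurable_head_rearr.
move=> s s0; rewrite tail01_head_rearr// ge_min; apply/orP; left.
apply: (le_trans (sum_tails_le s0)); apply: lee_wpmul2r; first exact: measure_ge0.
by rewrite lee_fin ler_nat ltnW// ltn_expl.
Qed.

(** The height [F^*(1)] at which the functions are cut. *)
Definition head_level := disjointification_rearr f 1.

Lemma head_level_ge0 : 0 <= head_level.
Proof. exact: rearr_ge0. Qed.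

(** Above this level the tails of the [f k] add up to at most 1, so that
    restricting [F^*] to [[0,1]] loses nothing there. *)
Lemma sum_tails_head_level r : head_level <= r ->
  (\sum_(k < n) tail01 (f k) r <= 1)%E.
Proof.
move=> ar; have a0 := head_level_ge0; have r0 := le_trans a0 ar.
apply: (@le_trans _ _ (\sum_(k < n) tail01 (f k) head_level)%E).
  apply: lee_sum => k _; apply: tail_anti => //; exact: measurable_tails01.
rewrite -tail_disjointification//; apply: tail_rearr_le.
  exact: measurable_tails_disjointification.
exact: vanishing_tails_disjointification.
Qed.

Lemma head_level_le_norm : head_level <= norm head_rearr.
Proof.
have a0 := head_level_ge0.
rewrite -[leLHS](ger0_norm a0) -(ss_cst X head_level).2.
apply: (ss_tail_le ss_head_rearr _ _).2; first exact: measurable_cst.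
move=> s s0; have [sa|sa] := ltP s head_level; last first.
  rewrite [leLHS](_ : _ = 0%E) ?measure_ge0//.
  rewrite /tail01 /tail (_ : _ `&` _ = set0) ?measure0//.
  by apply/seteqP; split=> // x [_ /=]; rewrite ger0_norm// ltNge sa.
apply: (@le_trans _ _ 1%E); first by apply: tail01_le1 => //; exact: measurable_cst.
rewrite tail01_head_rearr// le_min lexx andbT -tail_disjointification//.
rewrite ltW// -lt_rearr//; first exact: measurable_tails_disjointification.
exact: vanishing_tails_disjointification.
Qed.

End disjointification_rearrangement.

(** * Transformations of an independent family on the unit interval *)

Section extension_by_zero.
Context (R : realType) (n : nat) (f : 'I_n -> R -> R).
Hypotheses (mf : forall k, measurable_fun (unit_itv R) (f k))
  (indf : independent01 f).
Local Notation lam := (@lebesgue_measure R).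
Local Notation I01 := (unit_itv R).
Local Notation U01 := (@unif01 R).

(** Indices in [nat] fit [mutually_independent], and extension by zero makes the
    functions measurable on the whole line. *)
Definition nat_family (i : nat) : R -> R :=
  if insub i is Some k then restrict01 (f k) else cst 0.

Lemma measurable_nat_family i : measurable_fun setT (nat_family i).
Proof.
rewrite /nat_family; case: insubP => [k _ _|_]; last exact: measurable_cst.
exact: measurable_restrict01.
Qed.

Lemma nat_familyE (k : 'I_n) x : I01 x -> nat_family k x = f k x.
Proof. by move=> Ix; rewrite /nat_family valK restrict01E. Qed.

Section transformed.
Variable c : nat -> R -> R.
Hypothesis mc : forall i, measurable_fun setT (c i).

Let measurable_transformed i :
  measurable_fun setT (fun x : measurableTypeR R => c i (nat_family i x)).
Proof. by apply: measurableT_comp => //; exact: measurable_nat_family. Qed.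

Definition transformed i : {mfun (measurableTypeR R) >-> R} :=
  HB.pack (fun x : measurableTypeR R => c i (nat_family i x))
    (isMeasurableFun.Build _ _ _ _ _ (measurable_transformed i)).

Lemma transformed_independent : mutually_independent U01 n transformed.
Proof.
move=> A mA; pose A' (k : 'I_n) : set R := c k @^-1` A k.
have mA' k : measurable (A' k) by rewrite -[A' k]setTI; exact: mc.
have := indf [set: 'I_n]%SET mA'.
have onI (k : 'I_n) : I01 `&` transformed k @^-1` A k = I01 `&` f k @^-1` A' k.
  apply/seteqP; split=> x [Ix] /=; rewrite /A'/= nat_familyE//.
move=> h; apply: etrans (unif01E _) _.
rewrite (_ : I01 `&` _ = I01 `&` [set x | forall k, k \in [set: 'I_n]%SET -> A' k (f k x)]); last first.
  apply/seteqP; split=> x [Ix] /= Ax; split=> //.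
    by move=> k _; have := Ax k (ltn_ord k); rewrite /= nat_familyE.
  move=> i ilt; have := Ax (Ordinal ilt) (finset.in_setT _).
  by rewrite /A'/= -(nat_familyE (Ordinal ilt) Ix).
rewrite h; apply: eq_big => [k|k _]; first by rewrite finset.in_setT.
by rewrite -onI; exact/esym/unif01E.
Qed.

End transformed.
End extension_by_zero.

(** * The large and the small parts of the sum *)

Section truncated_parts.
Context (R : realType) (P : probability (seq_space R) R) (B : nat -> set R).
Context (X : symmetricSpace R).
Hypotheses (prodP : is_product_measure P) (kB : kruglov_sets B)
  (bK : kruglov_bounded P B X).
Context (n : nat) (f : 'I_n -> R -> R).
Hypotheses (Xf : forall k, X (f k)) (indf : independent01 f).
Local Notation lam := (@lebesgue_measure R).
Local Notation I01 := (unit_itv R).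
Local Notation norm := (ss_norm X).
Local Notation K := (kruglov_norm P B X).
Local Notation U01 := (@unif01 R).
Local Notation a := (head_level f).
Local Notation N := (norm (head_rearr f)).

Let mf k : measurable_fun I01 (f k).
Proof. exact: ss_measurable (Xf k). Qed.

Definition large (y : R) : R := if a < `|y| then y else 0.
Definition small (y : R) : R := if a < `|y| then 0 else y.

Lemma largeDsmall y : large y + small y = y.
Proof. by rewrite /large /small; case: ifP; rewrite ?addr0 ?add0r. Qed.

Let mlt : measurable_fun setT (fun y : R => a < `|y|).
Proof. by apply: measurable_fun_ltr => //; exact: measurableT_comp. Qed.

Lemma measurable_large : measurable_fun setT large.
Proof. exact: measurable_fun_ifT. Qed.

Lemma measurable_small : measurable_fun setT small.
Proof. exact: measurable_fun_ifT. Qed.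

Let c_abs (i : nat) (y : R) : R := `|large y|.

Let mc_abs i : measurable_fun setT (c_abs i).
Proof. by apply: measurableT_comp => //; exact: measurable_large. Qed.

Let Z := transformed mf mc_abs.

Let sum_tails_Z r : a <= r ->
  (\sum_(i < n) unif01 (Z i @^-1` `]r, +oo[) = \sum_(k < n) tail01 (f k) r)%E.
Proof.
move=> ar; apply: eq_bigr => k _; apply: etrans (unif01E _) _.
rewrite /tail01 /tail; congr (lam _); apply/seteqP; split=> x [Ix /=].
  rewrite in_itv/= andbT nat_familyE// /c_abs /large; case: ifP => // _.
  by rewrite normr0 => r0; split=> //=; have := head_level_ge0 f; lra.
move=> rf; split=> //=; rewrite in_itv/= andbT nat_familyE// /c_abs /large.
by rewrite (le_lt_trans ar rf).
Qed.

Let phi : {mfun R >-> R} :=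
  HB.pack (head_rearr f) (isMeasurableFun.Build _ _ _ _ _ (measurable_head_rearr Xf)).

(** The moduli of the large parts exceed [a] or vanish, and above [a] their tails
    add up to that of [head_rearr f]. *)
Lemma tail_sum_large_le (s : R) : 0 <= s ->
  (tail01 (fun x => \sum_(i < n) large (nat_family f i x))%R s <=
   (2 ^ 2)%:R%:E * tail01 (kruglov_rearr P B phi) s)%E.
Proof.
move=> s0.
have mL : measurable_fun setT (fun x => \sum_(i < n) large (nat_family f i x)).
  apply: measurable_sum => i; apply: measurableT_comp; first exact: measurable_large.
  exact: measurable_nat_family.
have mZ : measurable_fun setT (fun x : R => \sum_(i < n) Z i x).
  apply: measurable_sum => i; apply: (measurableT_comp (mc_abs i)).
  exact: measurable_nat_family.
have Z0 x : 0 <= \sum_(i < n) Z i x by apply: sumr_ge0 => i _; exact: normr_ge0.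
apply: (@le_trans _ _ (tail01 (fun x => \sum_(i < n) Z i x) s)).
  apply: tail01_le => //; [exact: measurable_funTS|exact: measurable_funTS|].
  by move=> x _; rewrite [leRHS]ger0_norm//; exact: ler_norm_sum.
have iZ : mutually_independent U01 n Z := transformed_independent mf indf mc_abs.
have iW : mutually_independent P n (jump phi) by exact: independent_jumps.
have Za i x : Z i x = 0 \/ a < Z i x.
  have -> : Z i x = `|large (nat_family f i x)| by [].
  by rewrite /large; case: ifP => h; [right|left; rewrite normr0].
have Zq r : a <= r -> (\sum_(i < n) U01 (Z i @^-1` `]r, +oo[) =
    distribution (@unifR R) phi `]r, +oo[%classic)%E.
  move=> ar; rewrite sum_tails_Z//; apply/esym.
  have r0 : 0 <= r by exact: le_trans (head_level_ge0 f) ar.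
  apply: (@etrans _ _ (tail01 (head_rearr f) r)).
    apply: etrans (unif01E _) _; rewrite /tail01 /tail; congr (lam _).
    by apply/seteqP; split=> x [Ix /=]; rewrite in_itv/= andbT ger0_norm ?head_rearr_ge0.
  rewrite (tail01_head_rearr Xf)//; apply/min_idPl.
  exact: (sum_tails_head_level Xf).
have Wq i g : (i < n)%N -> nnmeasurable g ->
    (\int[P]_x g (jump phi i x) = \int[distribution (@unifR R) phi]_y g y)%E.
  by move=> _; exact: integral_jump.
have dom := poisson_domination s iZ iW Za Zq Wq.
have -> : tail01 (fun x => \sum_(i < n) Z i x) s = U01 [set x | s < \sum_(i < n) Z i x].
  apply/esym; apply: etrans (unif01E _) _; rewrite /tail01 /tail; congr (lam (_ `&` _)).
  by apply/seteqP; split=> x /=; rewrite (ger0_norm (Z0 x)).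
apply: (le_trans dom).
rewrite big_ord_recl/= [X in (X + _)%E](_ : _ = 0%E) ?add0e; last first.
  rewrite (_ : [set x | _] = set0) ?measure0 ?mule0//.
  by apply/seteqP; split=> // x /=; rewrite big_ord0 ltNge s0.
have -> := tail01_kruglov P kB phi s0.
apply: le_trans (lee_wpmul2l _ (sum_le_tail_kruglov prodP phi kB n s0)); last by [].
rewrite ge0_sume_distrr; last first.
  by move=> m _; rewrite mule_ge0// lee_fin invr_ge0 mulr_ge0// expR_ge0.
apply: lee_sum => m _; rewrite muleA.
apply: lee_pmul.
- by rewrite lee_fin invr_ge0.
- exact: measure_ge0.
- exact: invfact_le_kruglov.
- apply: le_measure; rewrite ?inE.
  + have mS : measurable_fun setT (fun w => \sum_(i < m.+1) jump phi i w).
      by apply: measurable_sum => i; exact: measurable_funP.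
    have := mS measurableT _ (@measurable_itv R `]s, +oo[).
    by rewrite setTI; congr measurable; apply/seteqP; split=> w /=; rewrite in_itv/= andbT.
  + have mS : measurable_fun setT (fun w => `|\sum_(i < m.+1) jump phi i w|).
      apply: measurableT_comp => //.
      by apply: measurable_sum => i; exact: measurable_funP.
    have := mS measurableT _ (@measurable_itv R `]s, +oo[).
    by rewrite setTI; congr measurable; apply/seteqP; split=> w /=; rewrite in_itv/= andbT.
  + by move=> w /= h; rewrite (lt_le_trans h)// ler_norm.
Qed.

Lemma measurable_sum_large :
  measurable_fun setT (fun x => \sum_(i < n) large (nat_family f i x)).
Proof.
apply: measurable_sum => i; apply: measurableT_comp; first exact: measurable_large.
exact: measurable_nat_family.
Qed.

Lemma norm_sum_large :
  X (fun x => \sum_(i < n) large (nat_family f i x)) /\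
  norm (fun x => \sum_(i < n) large (nat_family f i x)) <= 4 * (K * N).
Proof.
have Xphi : X phi := ss_head_rearr Xf.
have Xk : X (kruglov_rearr P B phi) := bK.1 _ Xphi.
have mG : measurable_fun I01 (fun x => \sum_(i < n) large (nat_family f i x)).
  by apply: measurable_funTS; exact: measurable_sum_large.
have [XG nG] := ss_dilation Xk mG (fun s s0 => tail_sum_large_le s0).
split=> //; rewrite (le_trans nG)// ler_wpM2l//.
exact: (norm_kruglov_le kB bK Xphi).
Qed.

Let tail_large (k : 'I_n) (s : R) : 0 <= s ->
  tail01 (fun x => large (nat_family f k x)) s = tail01 (f k) (Num.max s a).
Proof.
move=> s0; rewrite /tail01 /tail; congr lam; apply/seteqP; split=> x [Ix /=].
  rewrite nat_familyE// /large; case: ifP => h.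
    by rewrite gt_max h andbT.
  by rewrite normr0 ltNge s0.
by rewrite gt_max => /andP[sx ax]; split=> //=; rewrite nat_familyE// /large ax.
Qed.

(** The sum of the tails of the large parts at [s] is that of the [f k] at
    [max s a], which is at most the tail of [head_rearr f] at [s]. *)
Lemma integral_sum_norm_large_le :
  (\int[lam]_(x in I01) (\sum_(i < n) `|large (nat_family f i x)|)%:E <= N%:E)%E.
Proof.
have mI := @measurable_unit_itv R.
have mL i : measurable_fun setT (fun x => large (nat_family f i x)).
  by apply: measurableT_comp; [exact: measurable_large|exact: measurable_nat_family].
under eq_integral do rewrite -sumEFin.
rewrite ge0_integral_sum//; last first.
  move=> i; apply/measurable_EFinP/measurable_funTS.
  by apply: measurableT_comp => //; exact: mL.
under eq_bigr do rewrite layer_cake01//.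
rewrite -ge0_integral_sum//; last first.
  by move=> i; apply: measurable_fun_tail01; apply: measurable_funTS; exact: mL.
apply: le_trans (ss_integral_le_norm (ss_head_rearr Xf)).
rewrite layer_cake01; last exact: (measurable_head_rearr Xf).
apply: ge0_le_integral => //.
- by move=> s _; exact: sume_ge0.
- by apply: emeasurable_sum => i; apply: measurable_fun_tail01; apply: measurable_funTS; exact: mL.
- by apply: measurable_fun_tail01; apply: measurable_funTS; exact: (measurable_head_rearr Xf).
- move=> s; rewrite /= in_itv/= andbT => s0.
  rewrite (tail01_head_rearr Xf)// (eq_bigr (fun k : 'I_n => tail01 (f k) (Num.max s a))); last first.
    by move=> k _; exact: tail_large.
  rewrite le_min (sum_tails_head_level Xf) ?le_max ?lexx ?orbT//.
  rewrite andbT; apply: lee_sum => k _; apply: tail_anti => //.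
    exact: measurable_tails01.
  by rewrite le_max lexx.
Qed.

Let h (i : nat) (x : measurableTypeR R) : R := small (nat_family f i x).

Let small_le y : `|small y| <= a.
Proof.
rewrite /small; case: ltP => // _.
by rewrite normr0; exact: head_level_ge0.
Qed.

Let bh i : bounded_rv (h i).
Proof.
split; last by exists a => x; exact: small_le.
apply: measurableT_comp; first exact: measurable_small.
exact: measurable_nat_family.
Qed.

Let bSh : bounded_rv (fun x => \sum_(i < n) h i x).
Proof. exact: bounded_rv_sum. Qed.

Let e := Er U01 (fun x => `|\sum_(i < n) h i x|).
Let m i := Er U01 (h i).
Let S x := \sum_(k < n) f k x.
Let E1 : R := \int[lam]_(x in I01) `|S x|.

Let e_ge0 : 0 <= e.
Proof. exact: Er_ge0. Qed.

Let sum_nat_family x : I01 x -> \sum_(i < n) nat_family f i x = S x.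
Proof. by move=> Ix; apply: eq_bigr => k _; rewrite nat_familyE. Qed.

Let XS : X S.
Proof. exact: ss_sum. Qed.

Let mS : measurable_fun I01 S.
Proof. exact: ss_measurable XS. Qed.

Let integral_S : (\int[lam]_(x in I01) `|S x|%:E = E1%:E)%E.
Proof.
rewrite /E1 /Rintegral fineK// ge0_fin_numE; last first.
  by apply: integral_ge0 => x _; rewrite lee_fin.
by rewrite (le_lt_trans (ss_integral_le_norm XS))// ltry.
Qed.

(** On [[0,1]] the sum of the small parts is [S] minus the sum of the large
    parts. *)
Lemma Er_norm_sum_small_le : e <= E1 + N.
Proof.
have mI := @measurable_unit_itv R.
rewrite -lee_fin EFinD -integral_S -ErE; last exact: bounded_rv_abs.
rewrite ge0_integral_unif01; last 2 first.
- apply/measurable_EFinP; exact: (bounded_rv_abs bSh).1.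
- by move=> x; rewrite lee_fin.
apply: le_trans (leeD2l _ integral_sum_norm_large_le).
rewrite -ge0_integralD//; last 3 first.
- apply/measurable_EFinP; exact: measurableT_comp.
- by move=> x _; rewrite lee_fin sumr_ge0.
- apply/measurable_EFinP/measurable_funTS; apply: measurable_sum => i.
  apply: measurableT_comp => //; apply: measurableT_comp; first exact: measurable_large.
  exact: measurable_nat_family.
apply: ge0_le_integral => //.
- by apply/measurable_EFinP/measurable_funTS; exact: (bounded_rv_abs bSh).1.
- apply: emeasurable_funD.
    by apply/measurable_EFinP; exact: measurableT_comp.
  apply/measurable_EFinP/measurable_funTS; apply: measurable_sum => i.
  apply: measurableT_comp => //; apply: measurableT_comp; first exact: measurable_large.
  exact: measurable_nat_family.
move=> x Ix; rewrite -EFinD lee_fin.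
have -> : \sum_(i < n) h i x = S x - \sum_(i < n) large (nat_family f i x).
  rewrite -sum_nat_family// -sumrB; apply: eq_bigr => i _.
  by apply/eqP; rewrite eq_sym subr_eq addrC largeDsmall.
by rewrite (le_trans (ler_normB _ _))// lerD2l ler_norm_sum.
Qed.

Lemma mean_sum_small_le : `|\sum_(i < n) m i| <= e.
Proof.
have bA := bounded_rv_abs bSh.
rewrite -(@Er_sum _ _ _ U01 n h bh) ler_norml; apply/andP; split.
  rewrite -[e]mul1r -mulNr -ErZ//; apply: Er_le => //.
    by apply: bounded_rvM => //; exact: bounded_rv_cst.
  by move=> x; rewrite mulN1r lerNl -normrN ler_norm.
by apply: Er_le => // x; exact: ler_norm.
Qed.

Let c_center (i : nat) (y : R) : R := small y - m i.

Let mc_center i : measurable_fun setT (c_center i).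
Proof. by apply: measurable_funB => //; exact: measurable_small. Qed.

Let Yc := transformed mf mc_center.

Let mi_le i : `|m i| <= a.
Proof.
rewrite ler_norml; apply/andP; split.
  rewrite -[leLHS](Er_cst U01); apply: Er_le => //; first exact: bounded_rv_cst.
  by move=> x; have := small_le (nat_family f i x); rewrite ler_norml => /andP[].
rewrite -[leRHS](Er_cst U01); apply: Er_le => //; first exact: bounded_rv_cst.
by move=> x; have := small_le (nat_family f i x); rewrite ler_norml => /andP[].
Qed.

Let Yc_le i x : `|Yc i x| <= 2 * a.
Proof.
rewrite (le_trans (ler_normB _ _))// mulr_natl mulr2n lerD//.
Qed.

Let Yc_mean i : Er U01 (Yc i) = 0.
Proof.
rewrite (_ : (Yc i : _ -> R) = (fun x => h i x + - m i))//.
by rewrite ErD// ?Er_cst ?subrr//; exact: bounded_rv_cst.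
Qed.

Let sum_Yc x : \sum_(i < n) Yc i x = \sum_(i < n) h i x - \sum_(i < n) m i.
Proof. by rewrite -sumrB. Qed.

Let variance_Yc : \sum_(i < n) Er U01 (fun x => Yc i x ^+ 2) <= (2 * a + 12 * e) ^+ 2.
Proof.
have iY := transformed_independent mf indf mc_center.
have a2 : 0 <= 2 * a by rewrite mulr_ge0// head_level_ge0.
apply: le_trans (variance_le iY a2 Yc_le Yc_mean (leqnn n)) _.
have bA := bounded_rv_abs bSh.
have E0 : 0 <= Er U01 (fun x => `|\sum_(i < n) Yc i x|) by exact: Er_ge0.
have bY : bounded_rv (fun x => \sum_(i < n) Yc i x).
  under eq_fun do rewrite sum_Yc; apply: bounded_rvD => //; exact: bounded_rv_cst.
have E2 : Er U01 (fun x => `|\sum_(i < n) Yc i x|) <= 2 * e.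
  apply: (@le_trans _ _ (Er U01 (fun x => `|\sum_(i < n) h i x| + e))).
    apply: Er_le; first exact: bounded_rv_abs.
      by apply: bounded_rvD => //; exact: bounded_rv_cst.
    move=> x; rewrite sum_Yc (le_trans (ler_normB _ _))// lerD2l.
    exact: mean_sum_small_le.
  rewrite ErD ?Er_cst//; last exact: bounded_rv_cst.
  by rewrite mulr_natl mulr2n.
rewrite lerXn2r ?nnegrE ?addr_ge0 ?mulr_ge0// ?head_level_ge0// lerD2l.
lra.
Qed.

(** After division by [b] the summands are at most 1 and the variance of the sum
    is at most 1. *)
Lemma norm_centered_small (b : R) : 0 < b -> 2 * a + 12 * e <= b ->
  X (fun x => \sum_(i < n) Yc i x) /\
  norm (fun x => \sum_(i < n) Yc i x) <= 16 * b * K.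
Proof.
move=> b0 eb.
have binv : 0 <= b^-1 by rewrite invr_ge0 ltW.
pose c_scale (i : nat) (y : R) : R := b^-1 * c_center i y.
have mc_scale i : measurable_fun setT (c_scale i) by exact: measurable_funM.
pose V := transformed mf mc_scale.
have VE i x : V i x = b^-1 * Yc i x by [].
have iV : mutually_independent U01 n V := transformed_independent mf indf mc_scale.
have bYi i : bounded_rv (Yc i).
  by split; [exact: measurable_funP|exists (2 * a)].
have V1 i x : `|V i x| <= 1.
  rewrite VE normrM (ger0_norm binv) ler_pdivrMl// mulr1.
  rewrite (le_trans (Yc_le i x))// (le_trans _ eb)// lerDl mulr_ge0//.
have V0 i : Er U01 (V i) = 0.
  rewrite (_ : (V i : _ -> R) = (fun x => b^-1 * Yc i x))//.
  by rewrite ErZ// Yc_mean mulr0.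
have Vs : \sum_(i < n) Er U01 (fun x => V i x ^+ 2) <= 1.
  rewrite (eq_bigr (fun i : 'I_n => b^-1 ^+ 2 * Er U01 (fun x => Yc i x ^+ 2))); last first.
    move=> i _; rewrite -ErZ; last exact: bounded_rvX.
    by congr Er; apply/funext => x; rewrite VE exprMn.
  rewrite -mulr_sumr exprVn ler_pdivrMl ?exprn_gt0// mulr1.
  rewrite (le_trans variance_Yc)// lerXn2r ?nnegrE ?(ltW b0)//.
  by rewrite addr_ge0// mulr_ge0// head_level_ge0.
apply: (norm_le_poisson_tail prodP kB bK b0).
  apply: measurable_funTS; apply: measurable_sum => i.
  by apply: (measurableT_comp (mc_center i)); exact: measurable_nat_family.
case=> // j _.
apply: le_trans (two_sided_tail_le_invfact j iV V1 V0 Vs).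
rewrite [leRHS](_ : _ = lam (I01 `&` [set x | (j.+1%:R <= `|\sum_(i < n) V i x|)%R])); last first.
  exact: unif01E.
rewrite (_ : [set x | (b * j.+1%:R <= _)%R] = [set x | (j.+1%:R <= `|\sum_(i < n) V i x|)%R])//.
have sumV x : \sum_(i < n) V i x = b^-1 * \sum_(i < n) Yc i x by rewrite mulr_sumr.
by apply/seteqP; split=> x /=; rewrite sumV normrM (ger0_norm binv) ler_pdivlMl.
Qed.

(** The constant is [4 + 16 * 14 + 4], for the large parts, the centred small
    parts and the means. *)
Lemma norm_sum_le : norm S <= 232 * K * (N + E1).
Proof.
have K0 : 0 <= K := kruglov_norm_ge0 bK.
have N0 : 0 <= N by apply: ss_norm_ge0; exact: (ss_head_rearr Xf).
have E0 : 0 <= E1 by rewrite -lee_fin -integral_S; apply: integral_ge0 => x _; rewrite lee_fin.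
have aN : a <= N := head_level_le_norm Xf.
have eE : e <= E1 + N := Er_norm_sum_small_le.
have [XG nG] := norm_sum_large.
have K1 : 1 <= 4 * K := one_le_kruglov_norm prodP kB bK.
have key eps : 0 < eps -> norm S <= 232 * K * (N + E1) + 16 * eps * K.
  move=> eps0; pose b : R := 14 * N + 12 * E1 + eps.
  have b0 : 0 < b by rewrite /b ltr_wpDl// addr_ge0// mulr_ge0.
  (* [a <= N] and [e <= E1 + N]; the term [eps] only makes [b] positive *)
  have eb : 2 * a + 12 * e <= b by rewrite /b; lra.
  have [XY nY] := norm_centered_small b0 eb.
  have [XM nM] := ss_cst X (\sum_(i < n) m i).
  have [_ nS] : X S /\ norm S <= norm ((fun x => \sum_(i < n) large (nat_family f i x))
      \+ ((fun x => \sum_(i < n) Yc i x) \+ cst (\sum_(i < n) m i))).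
    apply: ss_le_norm => //.
      by apply: ss_add => //; exact: ss_add.
    move=> x; rewrite inE => Ix /=; rewrite sum_Yc subrK -sum_nat_family//.
    rewrite -big_split/=; under [in leRHS]eq_bigr do rewrite largeDsmall.
    exact: lexx.
  rewrite (le_trans nS)// (le_trans (ss_norm_add XG (ss_add XY XM)))//.
  have nYM := ss_norm_add XY XM.
  have mM : norm (cst (\sum_(i < n) m i)) <= 4 * K * (E1 + N).
    rewrite nM (le_trans mean_sum_small_le)// (le_trans eE)//.
    by rewrite ler_peMl// addr_ge0.
  rewrite (le_trans (lerD nG (le_trans nYM (lerD nY mM))))// /b.
  have := mulr_ge0 K0 N0; have := mulr_ge0 K0 E0; nra.
apply/ler_addgt0Pr => eps eps0.
have K10 : 0 < 16 * (K + 1) by rewrite mulr_gt0// ltr_wpDl.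
have := key (eps / (16 * (K + 1))) (divr_gt0 eps0 K10).
move=> /le_trans; apply; rewrite lerD2l.
rewrite mulrA mulrAC ler_pdivrMr// [leRHS]mulrC mulrAC ler_pM2r//.
by rewrite ler_pM2l// lerDl.
Qed.

End truncated_parts.

(** * The theorem *)

Unset Implicit Arguments.

Theorem proposition16 (R : realType) :
  exists beta : R, 0 < beta /\
    forall (P : probability (seq_space R) R) (B : nat -> set R)
           (X : symmetricSpace R),
      is_product_measure P -> kruglov_sets B -> kruglov_bounded P B X ->
      forall (n : nat) (f : 'I_n -> R -> R),
        (forall k, X (f k)) -> independent01 f ->
        let S := fun x => \sum_(k < n) f k x in
        ss_norm X S <=
          beta * kruglov_norm P B X *
            (ss_norm X (fun t => disjointification_rearr f t * \1_(unit_itv R) t)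
             + \int[lebesgue_measure]_(x in unit_itv R) `|S x|).
Proof.
exists 232; split=> // P B X prodP kB bK n f Xf indf.
exact: norm_sum_le.
Qed.
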